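(* Let $f$ be a regular function on a domain $\Omega\subseteq\mathbb{H}$ and let $p\in\mathbb{H}$. There exists a sequence $\{a_n\}_{n\in\mathbb{Z}}$ in $\mathbb{H}$ such that, for all $0\le R_1<R_2\le+\infty$ with $\Sigma(p,R_1,R_2)\subseteq\Omega$, $$f(q)=\sum_{n\in\mathbb{Z}}(q-p)^{*n}a_n$$ in $\Sigma(p,R_1,R_2)$.
   Context: $\mathbb{H}$ denotes the quaternions, $\mathbb{S}=\{q\in\mathbb{H}:q^2=-1\}$, $x+y\mathbb{S}=\{x+Jy:J\in\mathbb{S}\}$; a domain is a connected open set. A function $f$ on an open set $\Omega\subseteq\mathbb{H}$ is regular if for all $I\in\mathbb{S}$ its restriction $f_I$ to $\Omega\cap(\mathbb{R}+I\mathbb{R})$ has continuous partial derivatives and $\frac12\left(\frac{\partial}{\partial x}+I\frac{\partial}{\partial y}\right)f_I(x+Iy)\equiv0$. For $p\in\mathbb{R}+I\mathbb{R}$ and $n\in\mathbb{N}$, $(q-p)^{*n}$ is the $n$-th power of $q\mapsto q-p$ for the product of polynomials $\left(\sum q^ka_k\right)*\left(\sum q^kb_k\right)=\sum_kq^k\sum_{l=0}^ka_lb_{k-l}$; it is the unique regular function on $\mathbb{H}$ whose restriction to $\mathbb{R}+I\mathbb{R}$ is $(z-p)^n$. For $m\in\mathbb{N}$ and $p=x+Iy$, $(q-p)^{*(-m)}=(q-p)^{-*m}=\left[(q-x)^2+y^2\right]^{-m}(q-\bar p)^{*m}$ on $\mathbb{H}\setminus(x+y\mathbb{S})$ (the regular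 reciprocal of $(q-p)^{*m}$), the unique regular function there whose restriction to $\mathbb{R}+I\mathbb{R}$ is $(z-p)^{-m}$; if $p\notin\mathbb{R}$, at $q=\bar p$ it is given the value $(\bar p-p)^{-m}$. $\sigma(q,p)=\tau(q,p)=|q-p|$ if $p,q$ lie on the same complex line $\mathbb{R}+I\mathbb{R}$ for some $I\in\mathbb{S}$; otherwise $$\sigma(q,p)=\sqrt{(\mathrm{Re}\,q-\mathrm{Re}\,p)^2+(|\mathrm{Im}\,q|+|\mathrm{Im}\,p|)^2},\qquad\tau(q,p)=\sqrt{(\mathrm{Re}\,q-\mathrm{Re}\,p)^2+(|\mathrm{Im}\,q|-|\mathrm{Im}\,p|)^2}.$$ $\Sigma(p,R_1,R_2)=\{q\in\mathbb{H}:\tau(q,p)>R_1,\ \sigma(q,p)<R_2\}$.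
   Formalization: One sequence for all shells is impossible (p=0, f=(q-3/2)^{-1}, shells Σ(0,0,1) and Σ(0,2,+∞)), so the sequence is chosen for each r>0 and serves all shells Σ(p,R_1,R_2) ⊆ Ω with R_1<r<R_2. *)

(* Defs.v *)
From Stdlib Require Import Reals ZArith Lra Lia ClassicalEpsilon.
From Coquelicot Require Import Coquelicot.

Open Scope R_scope.

(* [(a, b, c, d)] stands for a + b i + c j + d k *)

Definition quat : Type := (R * R * R * R)%type.

Definition qre (q : quat) : R := let '(a, _, _, _) := q in a.

Definition qmult (p q : quat) : quat :=
  let '(a1, b1, c1, d1) := p in
  let '(a2, b2, c2, d2) := q in
  (a1 * a2 - b1 * b2 - c1 * c2 - d1 * d2,
   a1 * b2 + b1 * a2 + c1 * d2 - d1 * c2,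
   a1 * c2 - b1 * d2 + c1 * a2 + d1 * b2,
   a1 * d2 + b1 * c2 - c1 * b2 + d1 * a2).

Definition quat_of_R (x : R) : quat := (x, 0, 0, 0).

(* Topology, real vector space structure and norm are those of the product
   R * R * R * R; its norm is the Euclidean one, see [norm_quat] below. *)

Canonical quat_UniformSpace :=
  UniformSpace.Pack quat (UniformSpace.class
    (prod_UniformSpace (prod_UniformSpace (prod_UniformSpace
       R_UniformSpace R_UniformSpace) R_UniformSpace) R_UniformSpace)) quat.

Canonical quat_AbelianMonoid :=
  AbelianMonoid.Pack quat (AbelianMonoid.class
    (prod_AbelianMonoid (prod_AbelianMonoid (prod_AbelianMonoid
       R_AbelianMonoid R_AbelianMonoid) R_AbelianMonoid) R_AbelianMonoid)) quat.

Canonical quat_AbelianGroup :=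
  AbelianGroup.Pack quat (AbelianGroup.class
    (prod_AbelianGroup (prod_AbelianGroup (prod_AbelianGroup
       R_AbelianGroup R_AbelianGroup) R_AbelianGroup) R_AbelianGroup)) quat.

Canonical quat_ModuleSpace :=
  ModuleSpace.Pack R_Ring quat (ModuleSpace.class R_Ring
    (prod_ModuleSpace R_Ring (prod_ModuleSpace R_Ring (prod_ModuleSpace R_Ring
       R_ModuleSpace R_ModuleSpace) R_ModuleSpace) R_ModuleSpace)) quat.

Canonical quat_NormedModuleAux :=
  NormedModuleAux.Pack R_AbsRing quat (NormedModuleAux.class R_AbsRing
    (prod_NormedModuleAux R_AbsRing (prod_NormedModuleAux R_AbsRing
       (prod_NormedModuleAux R_AbsRing
       R_NormedModuleAux R_NormedModuleAux) R_NormedModuleAux)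
       R_NormedModuleAux)) quat.

Canonical quat_NormedModule :=
  NormedModule.Pack R_AbsRing quat (NormedModule.class R_AbsRing
    (prod_NormedModule R_AbsRing (prod_NormedModule R_AbsRing
       (prod_NormedModule R_AbsRing
       R_NormedModule R_NormedModule) R_NormedModule) R_NormedModule)) quat.

Ltac quat_ring :=
  repeat match goal with |- forall _ : _, _ => intros [[[? ?] ?] ?] end;
  repeat (unfold qmult, quat_of_R, plus, opp, zero, prod_plus, prod_opp,
    prod_zero; simpl);
  repeat apply (f_equal2 pair); ring.

Definition quat_Ring_mixin : Ring.mixin_of quat_AbelianGroup.
Proof.
apply (Ring.Mixin quat_AbelianGroup qmult (quat_of_R 1)); quat_ring.
Defined.

Canonical quat_Ring :=
  Ring.Pack quat
    (Ring.Class quat (AbelianGroup.class quat_AbelianGroup) quat_Ring_mixin)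
    quat.

Declare Scope quat_scope.
Delimit Scope quat_scope with H.
Bind Scope quat_scope with quat.
Notation "p + q" := (@plus quat_AbelianMonoid p q) : quat_scope.
Notation "- p" := (@opp quat_AbelianGroup p) : quat_scope.
Notation "p - q" := (@minus quat_AbelianGroup p q) : quat_scope.
Notation "p * q" := (@mult quat_Ring p q) : quat_scope.
Notation "q ^ n" := (@pow_n quat_Ring q n%nat) : quat_scope.

Definition qconj (q : quat) : quat :=
  let '(a, b, c, d) := q in (a, - b, - c, - d).

Definition qnorm (q : quat) : R :=
  let '(a, b, c, d) := q in sqrt (a ^ 2 + b ^ 2 + c ^ 2 + d ^ 2).

Definition qimnorm (q : quat) : R :=
  let '(_, b, c, d) := q in sqrt (b ^ 2 + c ^ 2 + d ^ 2).

(* The inverse for q <> 0; junk value [qinv 0 = 0]. *)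
Definition qinv (q : quat) : quat :=
  scal (/ (qnorm q) ^ 2) (qconj q).

Lemma norm_quat (q : quat) : norm q = qnorm q.
Proof.
destruct q as [[[a b] c] d].
change (sqrt (sqrt (sqrt (Rabs a ^ 2 + Rabs b ^ 2) ^ 2 + Rabs c ^ 2) ^ 2
              + Rabs d ^ 2) = sqrt (a ^ 2 + b ^ 2 + c ^ 2 + d ^ 2)).
rewrite !pow2_sqrt, !pow2_abs; [reflexivity | ..];
  rewrite ?pow2_sqrt, ?pow2_abs; nra.
Qed.

Lemma qmult_inv_r (q : quat) : q <> zero -> mult q (qinv q) = one.
Proof.
destruct q as [[[a b] c] d]; intros Hq.
assert (Hs : 0 < a ^ 2 + b ^ 2 + c ^ 2 + d ^ 2).
{ destruct (Req_dec a 0) as [->|]; [|nra].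
  destruct (Req_dec b 0) as [->|]; [|nra].
  destruct (Req_dec c 0) as [->|]; [|nra].
  destruct (Req_dec d 0) as [->|]; [|nra].
  now elim Hq. }
unfold qinv, qnorm; rewrite pow2_sqrt by lra.
unfold mult, one, scal; simpl.
unfold quat_of_R, prod_scal, scal; simpl.
unfold prod_scal, scal; simpl.
unfold prod_scal, scal; simpl.
unfold mult; simpl.
repeat apply (f_equal2 pair); field; nra.
Qed.


Definition imag_unit (J : quat) : Prop := (J * J)%H = (- quat_of_R 1)%H.

Definition slice (I : quat) (x y : R) : quat := plus (quat_of_R x) (scal y I).

Definition on_line (I q : quat) : Prop := exists x y : R, q = slice I x y.

Definition same_line (p q : quat) : Prop :=
  exists I : quat, imag_unit I /\ on_line I p /\ on_line I q.

Definition connected_set (D : quat -> Prop) : Prop :=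
  forall U V : quat -> Prop,
    open U -> open V ->
    (forall q, D q -> U q \/ V q) ->
    (exists q, D q /\ U q) -> (exists q, D q /\ V q) ->
    exists q, D q /\ U q /\ V q.

Definition is_domain (D : quat -> Prop) : Prop := open D /\ connected_set D.

(* [fx] and [fy] are the partial derivatives of f_I; only their values at the
   points (x, y) with x + y I in Omega matter, and these form an open set. *)
Definition regular (f : quat -> quat) (Omega : quat -> Prop) : Prop :=
  forall I : quat, imag_unit I ->
  exists fx fy : R * R -> quat,
    forall x y : R, Omega (slice I x y) ->
      is_derive (fun t => f (slice I t y)) x (fx (x, y)) /\
      is_derive (fun t => f (slice I x t)) y (fy (x, y)) /\
      continuous fx (x, y) /\
      continuous fy (x, y) /\
      scal (/ 2) (fx (x, y) + I * fy (x, y))%H = zero.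


(* A polynomial [sum_k q^k a_k] is given by its coefficient sequence. *)

Definition poly_star (a b : nat -> quat) (k : nat) : quat :=
  sum_n (fun l => (a l * b (k - l)%nat)%H) k.

Definition poly_one (k : nat) : quat :=
  match k with O => one | _ => zero end.

Definition poly_lin (p : quat) (k : nat) : quat :=
  match k with O => (- p)%H | 1%nat => one | _ => zero end.

Fixpoint poly_lin_pow (p : quat) (n : nat) : nat -> quat :=
  match n with
  | O => poly_one
  | S m => poly_star (poly_lin_pow p m) (poly_lin p)
  end.

(* Justifies truncating at degree [n] the evaluation in [reg_pow] below. *)
Lemma poly_lin_pow_deg (p : quat) (n k : nat) :
  (n < k)%nat -> poly_lin_pow p n k = zero.
Proof.
revert k; induction n as [|n IH]; intros k Hk; simpl.
- destruct k; [lia | reflexivity].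
- unfold poly_star.
  rewrite (sum_n_ext_loc _ (fun _ => zero)).
  + unfold sum_n; rewrite sum_n_m_const_zero; reflexivity.
  + intros l Hl; destruct (le_lt_dec l n) as [Hln | Hln].
    * destruct (k - l)%nat as [|[|j]] eqn:E; [lia | lia | simpl poly_lin; apply (@mult_zero_r quat_Ring)].
    * rewrite IH by lia; apply (@mult_zero_l quat_Ring).
Qed.

Definition reg_pow (p : quat) (n : nat) (q : quat) : quat :=
  sum_n (fun k => (q ^ k * poly_lin_pow p n k)%H) n.

(* (q - p)^{*(-m)}; meaningless on the sphere of [p] except at [qconj p]
   when [p] is not real. *)
Definition reg_pow_neg (p : quat) (m : nat) (q : quat) : quat :=
  if excluded_middle_informative (q = qconj p) then
    (qinv (qconj p - p) ^ m)%H
  else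
    (qinv ((q - quat_of_R (qre p)) ^ 2 + quat_of_R (qimnorm p ^ 2)%R) ^ m
       * reg_pow (qconj p) m q)%H.

Definition reg_powZ (p : quat) (n : Z) (q : quat) : quat :=
  match n with
  | Z0 => reg_pow p 0 q
  | Zpos m => reg_pow p (Pos.to_nat m) q
  | Zneg m => reg_pow_neg p (Pos.to_nat m) q
  end.


Definition qsigma (q p : quat) : R :=
  if excluded_middle_informative (same_line p q) then qnorm (q - p)%H
  else sqrt ((qre q - qre p) ^ 2 + (qimnorm q + qimnorm p) ^ 2).

Definition qtau (q p : quat) : R :=
  if excluded_middle_informative (same_line p q) then qnorm (q - p)%H
  else sqrt ((qre q - qre p) ^ 2 + (qimnorm q - qimnorm p) ^ 2).

Definition shell (p : quat) (R1 : R) (R2 : Rbar) (q : quat) : Prop :=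
  R1 < qtau q p /\ Rbar_lt (qsigma q p) R2.

(* Both one-sided series converge and their sums add up to [s]. *)
Definition is_bilateral_series (u : Z -> quat) (s : quat) : Prop :=
  exists s1 s2 : quat,
    is_series (fun k : nat => u (Z.of_nat k)) s1 /\
    is_series (fun k : nat => u (- Z.of_nat (S k))%Z) s2 /\
    s = (s1 + s2)%H.

(* Main.v *)
(* Fix an imaginary unit I with p in R + I R.  The real coordinates of f along
   R + I R are real parts of the complex functions <m, f> + i <I m, f>, which are
   holomorphic, so f has a Laurent expansion about p on the annulus of that line;
   its coefficients are circle means, independent of the radius.  The expansion
   at z0 needs no Cauchy kernel: with kappa(w) = w (f(w) - f(z0)) / (w - z0), the
   means of w^-n (f(w) - f(z0)) telescope, and the mean of kappa is the same on
   circles inside and outside |w| = |z0|.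

   A point x + J y of the shell off that line has both x + I y and x - I y in the
   annulus.  Omega need not be axially symmetric and the planar region of such
   points may be disconnected, but an arc of the ellipse with foci p and its
   conjugate joins each of them to the real axis inside the region.  Hence f and
   its representation in terms of f(x + I y) and f(x - I y), which agree on the
   real axis, agree at x + J y; and the functions (q - p)^{*n} satisfy the same
   representation formula. *)
Require Import Defs.
From Stdlib Require Import Reals ZArith Lra Lia ClassicalEpsilon.
From Coquelicot Require Import Coquelicot.
Open Scope R_scope.

(** * Complex differentiability *)

(** Everything analytic rests on one fact: the mean over a circle has zero derivative in the radius,
    so it is constant. The mean value theorem asks for continuity only at the end radii, and this
    lets the mean of kappa cross the circle through z0: differentiability of f at z0 makes kappa
    continuous there, and kappa is holomorphic on either side.

    The expansion also propagates zeros, because the coefficients of a function that vanishes near a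
    centre are all 0. Propagation must start from an open set, whereas the two sides of the
    representation formula are first known to agree on the real axis only. Their difference,
    replaced by 0 below the axis, stays holomorphic and does vanish on an open set; hence the arcs
    are prolonged below the axis, to the conjugate point.

    Regularity is stated with left multiplication by I, so the values form a left complex vector
    space and the coefficients stand on the right, where associativity carries the factors of the
    representation formula past them. *)

Notation CU := (AbsRing_UniformSpace C_AbsRing).
Notation ccont f z := (@continuous CU CU f z).

Lemma Cmod_le_abs (z : C) : Cmod z <= Rabs (Re z) + Rabs (Im z).
Proof.
destruct z as [x y]; unfold Cmod; simpl fst; simpl snd; unfold Re, Im; simpl fst; simpl snd.
apply Rsqr_incr_0_var.
- rewrite Rsqr_sqrt by nra.
  rewrite <- (pow2_abs x), <- (pow2_abs y).
  unfold Rsqr; pose proof (Rabs_pos x); pose proof (Rabs_pos y); nra.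
- pose proof (Rabs_pos x); pose proof (Rabs_pos y); lra.
Qed.

Lemma abs_Im_le_Cmod (z : C) : Rabs (Im z) <= Cmod z.
Proof.
apply Rle_trans with (2 := Rmax_Cmod z), Rmax_r.
Qed.

Lemma Re_minus (z w : C) : Re (z - w)%C = Re z - Re w.
Proof. reflexivity. Qed.

Lemma Im_minus (z w : C) : Im (z - w)%C = Im z - Im w.
Proof. reflexivity. Qed.

Lemma continuous_C_iff {T : UniformSpace} (f : T -> C) (x : T) :
  @continuous T CU f x <->
  forall eps : posreal, locally x (fun y => Cmod (f y - f x)%C < eps).
Proof.
split.
- intros H eps; apply (H (fun w => Cmod (w - f x)%C < eps)).
  exists eps; intros w Hw; exact Hw.
- intros H P [eps HP]; specialize (H eps).
  unfold filtermap; revert H; apply filter_imp; intros y Hy; apply HP; exact Hy.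
Qed.

Lemma locally_CU (z : C) (P : C -> Prop) :
  @locally CU z P <-> exists d : posreal, forall w, Cmod (w - z)%C < d -> P w.
Proof. split; intros [d Hd]; exists d; intros w Hw; exact (Hd w Hw). Qed.

Lemma continuous_Re (z : C) : @continuous CU R_UniformSpace Re z.
Proof.
intros P [eps HP]; exists eps; intros w Hw; apply HP.
apply Rle_lt_trans with (2 := Hw).
change (Rabs (Re w - Re z) <= Cmod (w - z)%C).
rewrite <- Re_minus; apply re_le_Cmod.
Qed.

Lemma continuous_Im (z : C) : @continuous CU R_UniformSpace Im z.
Proof.
intros P [eps HP]; exists eps; intros w Hw; apply HP.
apply Rle_lt_trans with (2 := Hw).
change (Rabs (Im w - Im z) <= Cmod (w - z)%C).
rewrite <- Im_minus; apply abs_Im_le_Cmod.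
Qed.

Lemma continuous_Cpair {T : UniformSpace} (g h : T -> R) (x : T) :
  continuous g x -> continuous h x ->
  @continuous T CU (fun t => (g t, h t)) x.
Proof.
intros Hg Hh; apply continuous_C_iff; intros eps.
assert (He : 0 < eps / 2) by (destruct eps; simpl; lra).
assert (Hg' : locally x (fun y => Rabs (g y - g x) < eps / 2)).
{ apply (Hg (fun y => Rabs (y - g x) < eps / 2)).
  exists (mkposreal _ He); intros y Hy; exact Hy. }
assert (Hh' : locally x (fun y => Rabs (h y - h x) < eps / 2)).
{ apply (Hh (fun y => Rabs (y - h x) < eps / 2)).
  exists (mkposreal _ He); intros y Hy; exact Hy. }
generalize (filter_and _ _ Hg' Hh').
apply filter_imp; intros y [H1 H2].
eapply Rle_lt_trans; [apply Cmod_le_abs|].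
rewrite Re_minus, Im_minus; simpl; lra.
Qed.

Lemma continuous_Cconst {T : UniformSpace} (c : C) (x : T) :
  @continuous T CU (fun _ => c) x.
Proof. apply continuous_const. Qed.

Lemma ccont_id (z : C) : ccont (fun w => w) z.
Proof. apply continuous_id. Qed.

Lemma continuous_Cmult {T : UniformSpace} (f g : T -> C) (x : T) :
  @continuous T CU f x -> @continuous T CU g x ->
  @continuous T CU (fun y => (f y * g y)%C) x.
Proof. apply (@continuous_mult T C_AbsRing). Qed.

Lemma continuous_Cplus {T : UniformSpace} (f g : T -> C) (x : T) :
  @continuous T CU f x -> @continuous T CU g x ->
  @continuous T CU (fun y => (f y + g y)%C) x.
Proof. apply (@continuous_plus T C_AbsRing (AbsRing_NormedModule C_AbsRing)). Qed.

Lemma continuous_Cminus {T : UniformSpace} (f g : T -> C) (x : T) :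
  @continuous T CU f x -> @continuous T CU g x ->
  @continuous T CU (fun y => (f y - g y)%C) x.
Proof. apply (@continuous_minus T C_AbsRing (AbsRing_NormedModule C_AbsRing)). Qed.

Lemma continuous_Cpow {T : UniformSpace} (f : T -> C) (n : nat) (x : T) :
  @continuous T CU f x -> @continuous T CU (fun y => (f y ^ n)%C) x.
Proof.
intros Hf; induction n as [|n IH].
- apply (@continuous_Cconst T).
- apply (@continuous_Cmult T); assumption.
Qed.

Lemma ccont_const (c z : C) : ccont (fun _ => c) z.
Proof. apply (@continuous_Cconst CU). Qed.

Lemma ccont_plus (f g : C -> C) (z : C) :
  ccont f z -> ccont g z -> ccont (fun w => (f w + g w)%C) z.
Proof. apply (@continuous_Cplus CU). Qed.

Lemma ccont_minus (f g : C -> C) (z : C) :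
  ccont f z -> ccont g z -> ccont (fun w => (f w - g w)%C) z.
Proof. apply (@continuous_Cminus CU). Qed.

Lemma ccont_mult (f g : C -> C) (z : C) :
  ccont f z -> ccont g z -> ccont (fun w => (f w * g w)%C) z.
Proof. apply (@continuous_Cmult CU). Qed.

Lemma ccont_inv (z : C) : z <> 0%C -> ccont Cinv z.
Proof.
intros Hz; apply (@continuous_C_iff CU); intros eps.
assert (Hm : 0 < Cmod z) by now apply Cmod_gt_0.
assert (Hd : 0 < Rmin (Cmod z / 2) (eps * Cmod z * Cmod z / 2)).
{ apply Rmin_pos; [lra|].
  pose proof (cond_pos eps); assert (0 < eps * Cmod z) by (apply Rmult_lt_0_compat; lra).
  assert (0 < eps * Cmod z * Cmod z) by (apply Rmult_lt_0_compat; lra); lra. }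
apply locally_CU; exists (mkposreal _ Hd); intros w Hw; simpl in Hw.
assert (H1 := Rlt_le_trans _ _ _ Hw (Rmin_l _ _)).
assert (H2 := Rlt_le_trans _ _ _ Hw (Rmin_r _ _)).
assert (Hw2 : Cmod z / 2 < Cmod w).
{ assert (T := Cmod_triangle w (z - w)%C).
  replace (w + (z - w))%C with z in T by ring.
  replace (z - w)%C with (- (w - z))%C in T by ring.
  rewrite Cmod_opp in T; lra. }
assert (Hwnz : w <> 0%C) by (apply Cmod_gt_0; lra).
replace (/ w - / z)%C with (- ((w - z) / (w * z)))%C by (field; split; assumption).
rewrite Cmod_opp, Cmod_div by now apply Cmult_neq_0.
rewrite Cmod_mult.
apply Rmult_lt_reg_r with (Cmod w * Cmod z); [nra|].
unfold Rdiv at 1; rewrite Rmult_assoc, Rinv_l, Rmult_1_r by nra.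
apply Rlt_le_trans with (1 := H2).
pose proof (cond_pos eps).
assert (eps * Cmod z * (Cmod z / 2) <= eps * Cmod z * Cmod w).
{ apply Rmult_le_compat_l; [|lra]. apply Rmult_le_pos; lra. }
lra.
Qed.

Lemma continuous_Ccomp {T : UniformSpace} (f : T -> C) (g : C -> C) (x : T) :
  @continuous T CU f x -> ccont g (f x) -> @continuous T CU (fun y => g (f y)) x.
Proof. intros Hf Hg; exact (@continuous_comp T CU CU f g x Hf Hg). Qed.

Lemma ccont_comp (f g : C -> C) (z : C) :
  ccont f z -> ccont g (f z) -> ccont (fun w => g (f w)) z.
Proof. apply (@continuous_Ccomp CU). Qed.

Lemma ccont_ext_loc (f g : C -> C) (z : C) :
  @locally CU z (fun w => g w = f w) -> ccont g z -> ccont f z.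
Proof. apply (@continuous_ext_loc CU CU). Qed.

(* Caratheodory's form of complex differentiability: the difference quotient
   extends continuously to [z] with value [l]. *)
Definition cderiv (f : C -> C) (z l : C) : Prop :=
  exists phi : C -> C,
    ccont phi z /\ phi z = l /\ forall w, f w = (f z + phi w * (w - z))%C.

Lemma cderiv_continuous (f : C -> C) (z l : C) : cderiv f z l -> ccont f z.
Proof.
intros (phi & Hc & _ & Hf).
apply ccont_ext_loc with (fun w => (f z + phi w * (w - z))%C).
- apply filter_forall; intros w; symmetry; apply Hf.
- apply ccont_plus; [apply ccont_const|].
  apply ccont_mult; [exact Hc|].
  apply ccont_minus; [apply ccont_id | apply ccont_const].
Qed.

Lemma cderiv_ext_loc (f g : C -> C) (z l : C) :
  @locally CU z (fun w => g w = f w) -> cderiv f z l -> cderiv g z l.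
Proof.
intros He (phi & Hc & Hl & Hf).
assert (Hz : g z = f z) by exact (locally_singleton _ _ He).
(* The factor must satisfy its equation at every [w], not only near [z]. Where [g] differs from [f],
   hence away from [z], the difference quotient of [g] itself serves. *)
exists (fun w => if excluded_middle_informative (g w = f w) then phi w
                 else ((g w - g z) / (w - z))%C).
split; [|split].
- apply ccont_ext_loc with (2 := Hc).
  revert He; apply filter_imp; intros w Hw.
  now destruct (excluded_middle_informative _).
- now destruct (excluded_middle_informative _).
- intros w; destruct (excluded_middle_informative _) as [E|E].
  + now rewrite E, Hz.
  + assert (w <> z) by (intros ->; now apply E).
    field; now apply Cminus_eq_contra.
Qed.

Lemma cderiv_const (c z : C) : cderiv (fun _ => c) z 0%C.
Proof.
exists (fun _ => 0%C); repeat split; [apply ccont_const|].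
intros; ring.
Qed.

Lemma cderiv_id (z : C) : cderiv (fun w => w) z 1%C.
Proof.
exists (fun _ => 1%C); repeat split; [apply ccont_const|].
intros; ring.
Qed.

Lemma cderiv_minus (f g : C -> C) (z l m : C) :
  cderiv f z l -> cderiv g z m -> cderiv (fun w => (f w - g w)%C) z (l - m)%C.
Proof.
intros (phi & Hc & Hl & Hf) (psi & Hd & Hm & Hg).
exists (fun w => (phi w - psi w)%C); repeat split.
- now apply ccont_minus.
- now rewrite Hl, Hm.
- intros w; rewrite (Hf w), (Hg w); ring.
Qed.

Lemma cderiv_mult (f g : C -> C) (z l m : C) :
  cderiv f z l -> cderiv g z m ->
  cderiv (fun w => (f w * g w)%C) z (l * g z + f z * m)%C.
Proof.
intros Hf0 (psi & Hd & Hm & Hg).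
assert (Hcf := cderiv_continuous _ _ _ Hf0).
destruct Hf0 as (phi & Hc & Hl & Hf).
exists (fun w => (phi w * g z + f w * psi w)%C); repeat split.
- apply ccont_plus; apply ccont_mult; trivial; apply ccont_const.
- now rewrite Hl, Hm.
- intros w; rewrite (Hg w), (Hf w); ring.
Qed.

Lemma cderiv_inv (z : C) : z <> RtoC 0 -> cderiv Cinv z (- / (z * z))%C.
Proof.
intros Hz.
(* At [w = 0] the factor is solved from the equation, whatever value [/ 0] has; as [z] is nonzero,
   this leaves continuity at [z] intact. *)
exists (fun w : C => if excluded_middle_informative (w = RtoC 0)
                     then ((/ z - / w) / z)%C else (- / (w * z))%C); repeat split.
- apply ccont_ext_loc with (fun w => (- / z * / w)%C).
  + apply locally_CU; exists (mkposreal _ (proj1 (Cmod_gt_0 z) Hz)); simpl.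
    intros w Hw; destruct (excluded_middle_informative _) as [->|Hwn].
    * replace (0 - z)%C with (- z)%C in Hw by ring; rewrite Cmod_opp in Hw; lra.
    * field; now split.
  + apply ccont_mult; [apply ccont_const | now apply ccont_inv].
- now destruct (excluded_middle_informative _).
- intros w; destruct (excluded_middle_informative _) as [->|Hw].
  + generalize (/ RtoC 0)%C; intros k; field; assumption.
  + field; now split.
Qed.

Lemma cderiv_comp_shift (f : C -> C) (c z l : C) :
  cderiv f (c + z)%C l -> cderiv (fun w => f (c + w)%C) z l.
Proof.
intros (phi & Hc & Hl & Hf).
exists (fun w => phi (c + w)%C); repeat split.
- apply (ccont_comp (fun w => (c + w)%C) phi); [|exact Hc].
  apply ccont_plus; [apply ccont_const | apply ccont_id].
- exact Hl.
- intros w; rewrite (Hf (c + w)%C); f_equal; f_equal; ring.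
Qed.

(** Continuity of the derivative is part of the notion because circle means are differentiated under
    the integral sign. Openness of [D] is supplied separately where it matters. *)
Definition hol (D : C -> Prop) (f f' : C -> C) : Prop :=
  forall z, D z -> cderiv f z (f' z) /\ ccont f' z.

Lemma hol_minus (D : C -> Prop) (f f' g g' : C -> C) :
  hol D f f' -> hol D g g' ->
  hol D (fun w => (f w - g w)%C) (fun w => (f' w - g' w)%C).
Proof.
intros Hf Hg z Hz; split.
- now apply cderiv_minus; [apply Hf | apply Hg].
- now apply ccont_minus; [apply Hf | apply Hg].
Qed.

Lemma hol_mult (D : C -> Prop) (f f' g g' : C -> C) :
  hol D f f' -> hol D g g' ->
  hol D (fun w => (f w * g w)%C) (fun w => (f' w * g w + f w * g' w)%C).
Proof.
intros Hf Hg z Hz; destruct (Hf z Hz), (Hg z Hz); split.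
- now apply cderiv_mult.
- apply ccont_plus; apply ccont_mult; trivial;
    eapply cderiv_continuous; eassumption.
Qed.

Lemma hol_const (D : C -> Prop) (c : C) : hol D (fun _ => c) (fun _ => 0%C).
Proof. intros z _; split; [apply cderiv_const | apply ccont_const]. Qed.

Lemma hol_id (D : C -> Prop) : hol D (fun w => w) (fun _ => 1%C).
Proof. intros z _; split; [apply cderiv_id | apply ccont_const]. Qed.

Lemma hol_inv (D : C -> Prop) :
  (forall z, D z -> z <> 0%C) -> hol D Cinv (fun w => (- / (w * w))%C).
Proof.
intros HD z Hz; split; [now apply cderiv_inv, HD|].
apply ccont_ext_loc with (fun w => (0 - / (w * w))%C).
- apply filter_forall; intros w; ring.
- apply ccont_minus; [apply ccont_const|].
  apply (ccont_comp (fun w => (w * w)%C) Cinv).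
  + apply ccont_mult; apply ccont_id.
  + apply ccont_inv, Cmult_neq_0; now apply HD.
Qed.

Lemma hol_pow (D : C -> Prop) (f f' : C -> C) (n : nat) :
  hol D f f' -> exists g', hol D (fun w => (f w ^ n)%C) g'.
Proof.
intros Hf; induction n as [|n [g' IH]].
- exists (fun _ => 0%C); apply (hol_const D 1%C).
- eexists; exact (hol_mult _ _ _ _ _ Hf IH).
Qed.

Lemma hol_shift (D : C -> Prop) (f f' : C -> C) (c : C) :
  hol D f f' ->
  hol (fun z => D (c + z)%C) (fun w => f (c + w)%C) (fun w => f' (c + w)%C).
Proof.
intros Hf z Hz; destruct (Hf _ Hz); split.
- now apply cderiv_comp_shift.
- apply (ccont_comp (fun w => (c + w)%C) f'); [|assumption].
  apply ccont_plus; [apply ccont_const | apply ccont_id].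
Qed.

Lemma hol_sub (D D' : C -> Prop) (f f' : C -> C) :
  (forall z, D' z -> D z) -> hol D f f' -> hol D' f f'.
Proof. intros H Hf z Hz; now apply Hf, H. Qed.

Lemma hol_continuous (D : C -> Prop) (f f' : C -> C) (z : C) :
  hol D f f' -> D z -> ccont f z.
Proof. intros Hf Hz; eapply cderiv_continuous; now apply Hf. Qed.

(** * Circle means *)

(** A factor that vanishes at [t] lets the other be merely continuous. Along a curve this turns
    Caratheodory's equation into an ordinary real derivative. *)
Lemma is_derive_mult_vanishing (A k : R -> R) (t k' : R) :
  continuous A t -> is_derive k t k' -> k t = 0 ->
  is_derive (fun s => A s * k s) t (A t * k').
Proof.
intros HA Hk Hk0.
apply is_derive_Reals; apply is_derive_Reals in Hk.
intros eps Heps.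
(* The two error terms below are at most [e * (Rabs k' + 1)] and [Rabs (A t) * e], which add up to
   [e * M = eps / 2]. *)
set (M := Rabs k' + 1 + Rabs (A t)).
assert (HM : 0 < M) by (unfold M; pose proof (Rabs_pos k'); pose proof (Rabs_pos (A t)); lra).
assert (He : 0 < Rmin 1 (eps / (2 * M))).
{ apply Rmin_pos; [lra|]. apply Rdiv_lt_0_compat; lra. }
destruct (Hk _ He) as [d1 Hd1].
assert (HA' : locally t (fun s => Rabs (A s - A t) < Rmin 1 (eps / (2 * M)))).
{ apply (HA (fun y => Rabs (y - A t) < _)); exists (mkposreal _ He); intros y Hy; exact Hy. }
destruct HA' as [d2 Hd2].
assert (Hd : 0 < Rmin d1 d2) by (apply Rmin_pos; apply cond_pos).
exists (mkposreal _ Hd); intros h Hh0 Hh; simpl in Hh.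
assert (Q := Hd1 h Hh0 (Rlt_le_trans _ _ _ Hh (Rmin_l _ _))).
assert (P : Rabs (A (t + h) - A t) < Rmin 1 (eps / (2 * M))).
{ apply Hd2. change (Rabs (t + h - t) < d2). replace (t + h - t) with h by ring.
  exact (Rlt_le_trans _ _ _ Hh (Rmin_r _ _)). }
rewrite Hk0 in Q |- *.
set (q := (k (t + h) - 0) / h) in *.
replace ((A (t + h) * k (t + h) - A t * 0) / h - A t * k')
  with ((A (t + h) - A t) * q + A t * (q - k')) by (unfold q; field; assumption).
assert (Hq : Rabs q <= Rabs k' + 1).
{ replace q with (k' + (q - k')) by ring.
  eapply Rle_trans; [apply Rabs_triang|].
  pose proof (Rlt_le_trans _ _ _ Q (Rmin_l _ _)); lra. }
assert (Pe := Rlt_le_trans _ _ _ P (Rmin_r _ _)).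
assert (Qe := Rlt_le_trans _ _ _ Q (Rmin_r _ _)).
set (e := eps / (2 * M)) in *.
assert (Ee : e * M = eps / 2) by (unfold e; field; lra).
eapply Rle_lt_trans; [apply Rabs_triang|]; rewrite !Rabs_mult.
pose proof (Rabs_pos (A (t + h) - A t)); pose proof (Rabs_pos (A t));
pose proof (Rabs_pos q); pose proof (Rabs_pos (q - k')); pose proof (Rabs_pos k').
assert (Rabs (A (t + h) - A t) * Rabs q <= e * (Rabs k' + 1)).
{ apply Rmult_le_compat; lra. }
assert (Rabs (A t) * Rabs (q - k') <= Rabs (A t) * e).
{ apply Rmult_le_compat_l; lra. }
assert (e * M = e * (Rabs k' + 1) + Rabs (A t) * e) by (unfold M; ring).
lra.
Qed.

Lemma is_derive_Re_curve (f : C -> C) (g h : R -> R) (t g' h' : R) (l : C) :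
  cderiv f (g t, h t) l -> is_derive g t g' -> is_derive h t h' ->
  is_derive (fun s => Re (f (g s, h s))) t (Re (l * (g', h'))%C).
Proof.
intros (phi & Hc & Hl & Hf) Hg Hh.
assert (Hphi : @continuous R_UniformSpace CU (fun s => phi (g s, h s)) t).
{ apply (@continuous_Ccomp R_UniformSpace (fun s => (g s, h s)) phi t); [|exact Hc].
  apply (@continuous_Cpair R_UniformSpace);
    [apply (ex_derive_continuous g); now exists g' | apply (ex_derive_continuous h); now exists h']. }
apply is_derive_ext with
  (fun s => Re (f (g t, h t)) + (Re (phi (g s, h s)) * (g s - g t)
            + - (Im (phi (g s, h s)) * (h s - h t)))).
{ intros s; rewrite (Hf (g s, h s)); unfold Re, Im; simpl; ring. }
replace (Re (l * (g', h'))%C) with (0 + (Re l * g' + - (Im l * h')))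
  by (unfold Re, Im; simpl; ring).
rewrite <- Hl.
assert (D : forall (k : R -> R) k', is_derive k t k' -> is_derive (fun s => k s - k t) t k').
{ intros k k' Hk. replace k' with (k' - 0) by ring.
  apply (is_derive_minus k (fun _ => k t)); [exact Hk | apply (@is_derive_const R_AbsRing R_NormedModule)]. }
apply (is_derive_plus (fun _ => Re (f (g t, h t)))).
{ apply (@is_derive_const R_AbsRing R_NormedModule). }
apply (is_derive_plus (fun s => Re (phi (g s, h s)) * (g s - g t))).
- apply (is_derive_mult_vanishing (fun s => Re (phi (g s, h s)))); [|now apply D|ring].
  exact (@continuous_comp R_UniformSpace CU R_UniformSpace _ _ _ Hphi (continuous_Re _)).
- apply (is_derive_opp (fun s => Im (phi (g s, h s)) * (h s - h t))).
  apply (is_derive_mult_vanishing (fun s => Im (phi (g s, h s)))); [|now apply D|ring].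
  exact (@continuous_comp R_UniformSpace CU R_UniformSpace _ _ _ Hphi (continuous_Im _)).
Qed.

Lemma cderiv_scal (c : C) (f : C -> C) (z l : C) :
  cderiv f z l -> cderiv (fun w => (c * f w)%C) z (c * l)%C.
Proof.
intros Hf.
replace (c * l)%C with (0 * f z + c * l)%C by ring.
exact (cderiv_mult _ _ _ _ _ (cderiv_const c z) Hf).
Qed.

Lemma is_derive_Im_curve (f : C -> C) (g h : R -> R) (t g' h' : R) (l : C) :
  cderiv f (g t, h t) l -> is_derive g t g' -> is_derive h t h' ->
  is_derive (fun s => Im (f (g s, h s))) t (Im (l * (g', h'))%C).
Proof.
intros Hf Hg Hh.
assert (H := is_derive_Re_curve _ g h t g' h' _ (cderiv_scal (- Ci)%C _ _ _ Hf) Hg Hh).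
replace (Im (l * (g', h'))%C) with (Re (- Ci * l * (g', h'))%C)
  by (unfold Re, Im; simpl; ring).
revert H; apply is_derive_ext; intros s; unfold Re, Im; simpl; ring.
Qed.

Definition circ (rho t : R) : C := (rho * cos t, rho * sin t).

Lemma Cmod_circ (rho t : R) : 0 <= rho -> Cmod (circ rho t) = rho.
Proof.
intros Hr; unfold Cmod, circ; simpl fst; simpl snd.
replace ((rho * cos t) ^ 2 + (rho * sin t) ^ 2) with (rho ^ 2).
- apply sqrt_pow2; exact Hr.
- assert (H := sin2_cos2 t); unfold Rsqr in H.
  transitivity (rho ^ 2 * (sin t * sin t + cos t * cos t)); [rewrite H|]; ring.
Qed.

Lemma continuous_circ (rho t : R) :
  @continuous (prod_UniformSpace R_UniformSpace R_UniformSpace) CU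
    (fun p => circ (fst p) (snd p)) (rho, t).
Proof.
apply (@continuous_Cpair (prod_UniformSpace R_UniformSpace R_UniformSpace)
  (fun p => fst p * cos (snd p)) (fun p => fst p * sin (snd p)));
apply (continuous_mult (K := R_AbsRing) (U := prod_UniformSpace R_UniformSpace R_UniformSpace));
  try apply continuous_fst.
- apply (continuous_comp (U := prod_UniformSpace R_UniformSpace R_UniformSpace) snd cos); [apply continuous_snd|].
  apply continuous_cos.
- apply (continuous_comp (U := prod_UniformSpace R_UniformSpace R_UniformSpace) snd sin); [apply continuous_snd|].
  apply continuous_sin.
Qed.

Lemma continuous_circ_snd (rho t : R) :
  @continuous R_UniformSpace CU (circ rho) t.
Proof.
apply (@continuous_Cpair R_UniformSpace);
  apply (continuous_mult (K := R_AbsRing) (fun _ : R_UniformSpace => rho)).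
- apply continuous_const.
- apply continuous_cos.
- apply continuous_const.
- apply continuous_sin.
Qed.

Lemma continuous_circle_Re (f : C -> C) (rho t : R) :
  ccont f (circ rho t) -> continuous (fun s => Re (f (circ rho s))) t.
Proof.
intros Hf.
apply (@continuous_comp R_UniformSpace CU R_UniformSpace (fun s => f (circ rho s)) Re);
  [|apply continuous_Re].
apply (@continuous_Ccomp R_UniformSpace (circ rho) f); [|exact Hf].
apply continuous_circ_snd.
Qed.

Notation RxR := (prod_UniformSpace R_UniformSpace R_UniformSpace).

Lemma continuity_2d_Re (F : R * R -> C) (x y : R) :
  @continuous RxR CU F (x, y) -> continuity_2d_pt (fun r s => Re (F (r, s))) x y.
Proof.
intros HF; apply continuity_2d_pt_filterlim.
apply (filterlim_ext (fun p : R * R => Re (F p))); [intros [u v]; reflexivity|].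
exact (@continuous_comp RxR CU R_UniformSpace F Re (x, y) HF (continuous_Re _)).
Qed.

Lemma continuous_circle (f : C -> C) (rho t : R) :
  ccont f (circ rho t) ->
  @continuous RxR CU (fun p => f (circ (fst p) (snd p))) (rho, t).
Proof.
intros Hf.
apply (@continuous_Ccomp RxR (fun p => circ (fst p) (snd p)) f (rho, t)); [|exact Hf].
apply continuous_circ.
Qed.

Definition re_mean (f : C -> C) (rho : R) : R :=
  / (2 * PI) * RInt (fun t => Re (f (circ rho t))) 0 (2 * PI).

(** Since Im f = Re (- i f), the imaginary part is again a [re_mean], and each property of the mean
    follows from the real one used twice. *)
Definition mean (f : C -> C) (rho : R) : C :=
  (re_mean f rho, re_mean (fun w => (- Ci * f w)%C) rho).

Lemma circle_ex_RInt (f : C -> C) (rho : R) :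
  0 <= rho -> (forall w, Cmod w = rho -> ccont f w) ->
  ex_RInt (fun t => Re (f (circ rho t))) 0 (2 * PI).
Proof.
intros Hr Hf; apply (@ex_RInt_continuous R_CompleteNormedModule); intros t _.
apply continuous_circle_Re, Hf, Cmod_circ, Hr.
Qed.

Lemma circ_per (rho : R) : circ rho (2 * PI) = circ rho 0.
Proof. unfold circ; rewrite cos_2PI, sin_2PI, cos_0, sin_0; reflexivity. Qed.

(* The angular derivative of [f] on a circle is [i rho] times its radial
   derivative, and it integrates to [0]. *)
Lemma is_derive_re_mean (f f' : C -> C) (a b rho : R) :
  0 <= a -> a < rho < b -> hol (fun w => a < Cmod w < b) f f' ->
  is_derive (re_mean f) rho 0.
Proof.
intros Ha Hrho Hf.
assert (Hloc : locally rho (fun r => a < r < b)).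
{ apply filter_and; [apply (open_gt a); lra | apply (open_lt b); lra]. }
assert (Hin : forall r t, a < r < b -> a < Cmod (circ r t) < b).
{ intros r t Hr; rewrite Cmod_circ; lra. }
assert (Hd : forall r t, a < r < b ->
  is_derive (fun s => Re (f (circ s t))) r (Re (f' (circ r t) * (cos t, sin t))%C)).
{ intros r t Hr; unfold circ.
  apply (is_derive_Re_curve f (fun s => s * cos t) (fun s => s * sin t)).
  - apply Hf, Hin, Hr.
  - auto_derive; [trivial | ring].
  - auto_derive; [trivial | ring]. }
assert (Ht : forall t,
  is_derive (fun s => Im (f (circ rho s))) t (rho * Re (f' (circ rho t) * (cos t, sin t))%C)).
{ intros t; unfold circ.
  assert (H : is_derive (fun s => Im (f (rho * cos s, rho * sin s))) t
    (Im (f' (circ rho t) * ((rho * - sin t)%R, (rho * cos t)%R))%C)).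
  { apply (is_derive_Im_curve f (fun s => rho * cos s) (fun s => rho * sin s)).
    - apply Hf, Hin; lra.
    - auto_derive; [trivial | ring].
    - auto_derive; [trivial | ring]. }
  revert H; unfold circ, Re, Im; simpl; intros H.
  match type of H with is_derive _ _ ?x => match goal with |- is_derive _ _ ?y =>
    replace y with x by ring end end; exact H. }
assert (Hc2 : forall t,
  continuity_2d_pt (fun r s => Re (f' (circ r s) * (cos s, sin s))%C) rho t).
{ intros t.
  apply (continuity_2d_Re (fun p => (f' (circ (fst p) (snd p)) * (cos (snd p), sin (snd p)))%C)).
  apply (@continuous_Cmult RxR).
  - apply continuous_circle, Hf, Hin, Hrho.
  - apply (@continuous_Cpair RxR).
    + apply (continuous_comp (U := RxR) snd cos); [apply continuous_snd|apply continuous_cos].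
    + apply (continuous_comp (U := RxR) snd sin); [apply continuous_snd|apply continuous_sin]. }
assert (HI : RInt (fun t => Re (f' (circ rho t) * (cos t, sin t))%C) 0 (2 * PI) = 0).
{ apply is_RInt_unique.
  assert (H : is_RInt (fun t => scal (/ rho) (rho * Re (f' (circ rho t) * (cos t, sin t))%C))
    0 (2 * PI) (scal (/ rho) (minus (Im (f (circ rho (2 * PI)))) (Im (f (circ rho 0)))))).
  { apply (is_RInt_scal (V := R_NormedModule)).
    apply (is_RInt_derive (V := R_CompleteNormedModule) (fun t => Im (f (circ rho t)))).
    - intros t _; apply Ht.
    - intros t _.
      apply (continuous_mult (K := R_AbsRing) (fun _ : R_UniformSpace => rho)); [apply continuous_const|].
      apply (@continuous_comp R_UniformSpace CU R_UniformSpace _ Re); [|apply continuous_Re].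
      apply (@continuous_Cmult R_UniformSpace).
      + apply (@continuous_Ccomp R_UniformSpace (circ rho) f'); [apply continuous_circ_snd|].
        apply Hf, Hin, Hrho.
      + apply (@continuous_Cpair R_UniformSpace); [apply continuous_cos | apply continuous_sin]. }
  rewrite circ_per in H.
  replace 0 with (scal (/ rho) (minus (Im (f (circ rho 0))) (Im (f (circ rho 0))))) at 2.
  - revert H; apply is_RInt_ext; intros t _.
    change (/ rho * (rho * Re (f' (circ rho t) * (cos t, sin t))%C)
            = Re (f' (circ rho t) * (cos t, sin t))%C).
    field; lra.
  - unfold scal, minus, plus, opp; simpl; unfold mult; simpl; ring. }
replace 0 with (/ (2 * PI) * 0) by ring.
apply is_derive_scal.
assert (HD : forall r t, a < r < b ->
  Derive (fun u => Re (f (circ u t))) r = Re (f' (circ r t) * (cos t, sin t))%C).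
{ intros r t Hr; apply is_derive_unique, Hd, Hr. }
assert (HI' : RInt (fun t => Derive (fun u => Re (f (circ u t))) rho) 0 (2 * PI) = 0).
{ etransitivity; [|exact HI]; apply RInt_ext; intros t _; apply HD, Hrho. }
match goal with |- is_derive ?F _ _ =>
  enough (H : is_derive F rho (RInt (fun t => Derive (fun u => Re (f (circ u t))) rho) 0 (2 * PI)))
    by (rewrite HI' in H; exact H) end.
apply (is_derive_RInt_param (fun u t => Re (f (circ u t))) 0 (2 * PI) rho).
- revert Hloc; apply filter_imp; intros r Hr t _.
  eexists; apply Hd, Hr.
- intros t _.
  apply continuity_2d_pt_ext_loc with (2 := Hc2 t).
  destruct Hloc as [d Hd']; exists d; intros u v Hu _; symmetry; apply HD, Hd', Hu.
- revert Hloc; apply filter_imp; intros r Hr.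
  apply circle_ex_RInt; [lra|].
  intros w Hw; apply (hol_continuous _ _ _ _ Hf); lra.
Qed.

(** Serves the end radii in the mean value theorem, where [f] may be continuous without being
    holomorphic. *)
Lemma continuity_re_mean (f : C -> C) (rho : R) :
  0 < rho -> @locally R_UniformSpace rho (fun r => forall w, Cmod w = r -> ccont f w) ->
  continuity_pt (re_mean f) rho.
Proof.
intros Hrho Hf.
assert (Hrho' : locally rho (fun r => 0 < r)) by (apply (open_gt 0); lra).
assert (Hfr : forall w, Cmod w = rho -> ccont f w) by exact (locally_singleton _ _ Hf).
apply continuity_pt_filterlim, filterlim_locally; intros eps.
assert (HP := PI_RGT_0).
assert (He : 0 < eps / 2) by (destruct eps; simpl; lra).
destruct (uniform_continuity_2d_1d' (fun r t => Re (f (circ r t))) 0 (2 * PI) rho) with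
  (eps := mkposreal _ He) as [d Hd].
{ intros t _; apply (continuity_2d_Re (fun p => f (circ (fst p) (snd p)))), continuous_circle, Hfr.
  apply Cmod_circ; lra. }
generalize (filter_and _ _ (filter_and _ _ Hf Hrho') (locally_ball rho d)).
apply filter_imp; intros r [[Hr Hr0] Hb].
change (Rabs (r - rho) < d) in Hb.
change (Rabs (re_mean f r - re_mean f rho) < eps).
unfold re_mean.
assert (E1 : ex_RInt (fun t => Re (f (circ r t))) 0 (2 * PI)) by (apply circle_ex_RInt; [lra|exact Hr]).
assert (E2 : ex_RInt (fun t => Re (f (circ rho t))) 0 (2 * PI)) by (apply circle_ex_RInt; [lra|exact Hfr]).
rewrite <- Rmult_minus_distr_l.
change (Rabs (/ (2 * PI) * minus (RInt (fun t => Re (f (circ r t))) 0 (2 * PI))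
  (RInt (fun t => Re (f (circ rho t))) 0 (2 * PI))) < eps).
rewrite <- (RInt_minus (V := R_CompleteNormedModule)) by assumption.
rewrite Rabs_mult, Rabs_inv, (Rabs_pos_eq (2 * PI)) by lra.
apply Rle_lt_trans with (/ (2 * PI) * ((2 * PI - 0) * (eps / 2))).
- apply Rmult_le_compat_l; [left; apply Rinv_0_lt_compat; lra|].
  apply abs_RInt_le_const; [lra | apply (@ex_RInt_minus R_NormedModule); assumption |].
  intros t Ht; left.
  apply (Hd t rho t r); try lra.
  + destruct d; simpl in *; lra.
  + apply Rabs_def2 in Hb; lra.
  + rewrite Rminus_eq_0, Rabs_R0; apply cond_pos.
- destruct eps as [e He']; simpl in *.
  replace (/ (2 * PI) * ((2 * PI - 0) * (e / 2))) with (e / 2) by (field; lra); lra.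
Qed.

Lemma re_mean_const (f f' : C -> C) (R1 R2 a b : R) :
  0 <= R1 -> R1 < a -> a <= b -> b < R2 ->
  (forall w, R1 < Cmod w < R2 -> ccont f w) ->
  hol (fun w => a < Cmod w < b) f f' ->
  re_mean f a = re_mean f b.
Proof.
intros H0 H1 Hab H2 Hc Hf.
destruct (MVT_gen (re_mean f) a b (fun _ => 0)) as (c & _ & E).
- intros x Hx; rewrite Rmin_left, Rmax_right in Hx by lra.
  apply (is_derive_re_mean f f' a b); trivial; lra.
- intros x Hx; rewrite Rmin_left, Rmax_right in Hx by lra.
  apply continuity_re_mean; [lra|].
  apply filter_imp with (fun r => R1 < r < R2).
  + intros r Hr w Hw; apply Hc; lra.
  + apply filter_and; [apply (open_gt R1); lra | apply (open_lt R2); lra].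
- lra.
Qed.

Lemma mean_const_aux (f f' : C -> C) (R1 R2 a b : R) :
  0 <= R1 -> R1 < a -> a <= b -> b < R2 ->
  (forall w, R1 < Cmod w < R2 -> ccont f w) ->
  hol (fun w => a < Cmod w < b) f f' ->
  mean f a = mean f b.
Proof.
intros H0 H1 Hab H2 Hc Hf; unfold mean.
assert (Hf' := hol_mult _ _ _ _ _ (hol_const _ (- Ci)%C) Hf).
rewrite (re_mean_const f f' R1 R2 a b) by assumption.
f_equal; apply (re_mean_const _ _ R1 R2 a b H0 H1 Hab H2) with (2 := Hf').
intros w Hw; apply ccont_mult; [apply ccont_const | now apply Hc].
Qed.

Lemma mean_const (f f' : C -> C) (R1 R2 a b : R) :
  0 <= R1 -> hol (fun w => R1 < Cmod w < R2) f f' ->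
  R1 < a < R2 -> R1 < b < R2 -> mean f a = mean f b.
Proof.
intros H0 Hf.
assert (Hw : forall a b, R1 < a < R2 -> R1 < b < R2 -> a <= b -> mean f a = mean f b).
{ clear a b; intros a b Ha Hb Hab.
  apply (mean_const_aux f f' R1 R2); trivial; try lra.
  - intros w Hw; exact (hol_continuous _ _ _ _ Hf Hw).
  - apply (hol_sub _ _ _ _ (fun w Hw => conj (Rlt_trans _ _ _ (proj1 Ha) (proj1 Hw))
      (Rlt_trans _ _ _ (proj2 Hw) (proj2 Hb))) Hf). }
intros Ha Hb; destruct (Rle_or_lt a b).
- now apply Hw.
- symmetry; apply Hw; trivial; lra.
Qed.

(** The exceptional circle is a common boundary of two annuli, and at a boundary radius continuity
    suffices. *)
Lemma mean_const_across (f f' : C -> C) (R1 R2 a c b : R) :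
  0 <= R1 -> R1 < a -> a <= c -> c <= b -> b < R2 ->
  (forall w, R1 < Cmod w < R2 -> ccont f w) ->
  hol (fun w => R1 < Cmod w < R2 /\ Cmod w <> c) f f' ->
  mean f a = mean f b.
Proof.
intros H0 H1 Hac Hcb H2 Hc Hf.
transitivity (mean f c); apply (mean_const_aux f f' R1 R2); trivial; try lra;
  apply hol_sub with (2 := Hf); intros w Hw; lra.
Qed.

Lemma re_mean_ext (f g : C -> C) (rho : R) :
  0 <= rho -> (forall w, Cmod w = rho -> f w = g w) -> re_mean f rho = re_mean g rho.
Proof.
intros Hr H; unfold re_mean; f_equal.
apply RInt_ext; intros t _; f_equal; apply H, Cmod_circ, Hr.
Qed.

Lemma mean_ext (f g : C -> C) (rho : R) :
  0 <= rho -> (forall w, Cmod w = rho -> f w = g w) -> mean f rho = mean g rho.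
Proof.
intros Hr H; unfold mean; f_equal; apply re_mean_ext; trivial.
intros w Hw; now rewrite H.
Qed.

Lemma re_mean_lin (f g : C -> C) (c d : R) (rho : R) :
  0 <= rho -> (forall w, Cmod w = rho -> ccont f w) ->
  (forall w, Cmod w = rho -> ccont g w) ->
  re_mean (fun w => (c * f w + d * g w)%C) rho = c * re_mean f rho + d * re_mean g rho.
Proof.
intros Hr Hf Hg; unfold re_mean.
apply (circle_ex_RInt _ _ Hr) in Hf; apply (circle_ex_RInt _ _ Hr) in Hg.
erewrite (RInt_ext _ (fun t => plus (scal c (Re (f (circ rho t)))) (scal d (Re (g (circ rho t)))))).
2: { intros t _; unfold plus, scal, mult, Re; simpl; unfold mult; simpl; ring. }
rewrite (RInt_plus (V := R_CompleteNormedModule)) by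
  (apply (@ex_RInt_scal R_NormedModule); assumption).
rewrite !(RInt_scal (V := R_CompleteNormedModule)) by assumption.
unfold plus, scal, mult; simpl; unfold mult; simpl; ring.
Qed.

Lemma C_ext (z w : C) : Re z = Re w -> Im z = Im w -> z = w.
Proof.
destruct z as [x y], w as [u v]; unfold Re, Im; simpl; intros -> ->; reflexivity.
Qed.

Lemma mean_minus (rho : R) (f g : C -> C) :
  0 <= rho -> (forall w, Cmod w = rho -> ccont f w) ->
  (forall w, Cmod w = rho -> ccont g w) ->
  mean (fun w => (f w - g w)%C) rho = (mean f rho - mean g rho)%C.
Proof.
intros Hr Hf Hg.
assert (Hm : forall h : C -> C, (forall w, Cmod w = rho -> ccont h w) ->
          forall w, Cmod w = rho -> ccont (fun w => (- Ci * h w)%C) w).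
{ intros h Hh w Hw; apply ccont_mult; [apply ccont_const | now apply Hh]. }
apply C_ext; unfold mean, Re, Im; simpl.
- rewrite <- (re_mean_ext (fun w => (1 * f w + (-1) * g w)%C)), re_mean_lin; trivial.
  + ring.
  + intros w _; ring.
- rewrite <- (re_mean_ext (fun w => (1 * (- Ci * f w) + (-1) * (- Ci * g w))%C)); trivial.
  + rewrite (re_mean_lin (fun w => - Ci * f w)%C (fun w => - Ci * g w)%C); auto; ring.
  + intros w _; ring.
Qed.

Lemma mean_scal (rho : R) (f : C -> C) (c : C) :
  0 <= rho -> (forall w, Cmod w = rho -> ccont f w) ->
  mean (fun w => (c * f w)%C) rho = (c * mean f rho)%C.
Proof.
intros Hr Hf.
assert (Hm : forall w, Cmod w = rho -> ccont (fun w => (- Ci * f w)%C) w).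
{ intros w Hw; apply ccont_mult; [apply ccont_const | now apply Hf]. }
destruct c as [x y].
apply C_ext; unfold mean, Re, Im; simpl.
(* Complex scaling is a real combination of [f] and [- i f]: (x + i y) f = x f - y (- i f), and - i
   (x + i y) f = y f + x (- i f). *)
- rewrite <- (re_mean_ext (fun w => (x * f w + (- y)%R * (- Ci * f w))%C)); trivial.
  + rewrite (re_mean_lin f (fun w => - Ci * f w)%C); auto; ring.
  + intros w _; apply C_ext; unfold Re, Im; simpl; ring.
- rewrite <- (re_mean_ext (fun w => (y * f w + x * (- Ci * f w))%C)); trivial.
  + rewrite (re_mean_lin f (fun w => - Ci * f w)%C); auto; ring.
  + intros w _; apply C_ext; unfold Re, Im; simpl; ring.
Qed.

(** The factor 2 comes from bounding the two coordinates of the mean separately; it is absorbed by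
    the constants of the geometric estimates. *)
Lemma mean_bound (rho : R) (f : C -> C) (M : R) :
  0 <= rho -> (forall w, Cmod w = rho -> ccont f w) ->
  (forall t, 0 <= t <= 2 * PI -> Cmod (f (circ rho t)) <= M) ->
  Cmod (mean f rho) <= 2 * M.
Proof.
intros Hr Hf HM; assert (HP := PI_RGT_0).
assert (B : forall h : C -> C, (forall w, Cmod w = rho -> ccont h w) ->
  (forall t, 0 <= t <= 2 * PI -> Cmod (h (circ rho t)) <= M) -> Rabs (re_mean h rho) <= M).
{ intros h Hh HhM; unfold re_mean.
  rewrite Rabs_mult, Rabs_inv, (Rabs_pos_eq (2 * PI)) by lra.
  apply Rle_trans with (/ (2 * PI) * ((2 * PI - 0) * M)).
  - apply Rmult_le_compat_l; [left; apply Rinv_0_lt_compat; lra|].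
    apply abs_RInt_le_const; [lra | now apply circle_ex_RInt |].
    intros t Ht; eapply Rle_trans; [apply re_le_Cmod | now apply HhM].
  - right; field; lra. }
eapply Rle_trans; [apply Cmod_le_abs|].
assert (B1 := B f Hf HM).
assert (B2 : Rabs (re_mean (fun w => (- Ci * f w)%C) rho) <= M).
{ apply B.
  - intros w Hw; apply ccont_mult; [apply ccont_const | now apply Hf].
  - intros t Ht; rewrite Cmod_mult, Cmod_opp, Cmod_Ci, Rmult_1_l; now apply HM. }
unfold mean, Re, Im; simpl; lra.
Qed.

Lemma circle_bounded (rho : R) (f : C -> C) :
  0 <= rho -> (forall w, Cmod w = rho -> ccont f w) ->
  exists M, forall t, 0 <= t <= 2 * PI -> Cmod (f (circ rho t)) <= M.
Proof.
intros Hr Hf; assert (HP := PI_RGT_0).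
destruct (continuity_ab_maj (fun t => Cmod (f (circ rho t))) 0 (2 * PI)) as (t0 & H0 & _).
- lra.
- intros t _; apply continuity_pt_filterlim.
  apply (@continuous_comp R_UniformSpace CU R_UniformSpace (fun s => f (circ rho s)) Cmod).
  + apply (@continuous_Ccomp R_UniformSpace (circ rho) f); [apply continuous_circ_snd|].
    apply Hf, Cmod_circ, Hr.
  + apply (@filterlim_norm C_AbsRing (AbsRing_NormedModule C_AbsRing)).
- exists (Cmod (f (circ rho t0))); exact H0.
Qed.

Lemma mean_const_fun (c : C) (rho : R) : mean (fun _ => c) rho = c.
Proof.
assert (HP := PI_RGT_0).
apply C_ext; unfold mean, re_mean; destruct c as [x y]; unfold Re, Im; simpl;
  rewrite RInt_const; unfold scal; simpl; unfold mult; simpl; field; lra.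
Qed.

Lemma Cmod_le_small (c : C) :
  (forall e, 0 < e <= 1 -> Cmod c <= 2 * e) -> c = RtoC 0.
Proof.
intros H; apply Cmod_eq_0; pose proof (Cmod_ge_0 c).
destruct (Req_dec (Cmod c) 0) as [E|E]; [exact E|].
assert (0 < Rmin 1 (Cmod c / 4)) by (apply Rmin_pos; lra).
assert (T := H (Rmin 1 (Cmod c / 4)) (conj H1 (Rmin_l _ _))).
pose proof (Rmin_r 1 (Cmod c / 4)); lra.
Qed.

Lemma pow_le_self (e : R) (n : nat) : 0 <= e <= 1 -> e ^ S n <= e.
Proof.
intros He; simpl.
assert (0 <= e ^ n) by (apply pow_le; lra).
assert (H1 : e ^ n <= 1 ^ n) by (apply pow_incr; lra).
rewrite pow1 in H1; nra.
Qed.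

(** The mean is independent of the radius, and on the circle of radius [e <= 1] the integrand has
    modulus at most [e]. *)
Lemma mean_pow_pos (n : nat) (rho : R) :
  0 < rho -> mean (fun w => (w ^ S n)%C) rho = RtoC 0.
Proof.
intros Hrho; apply Cmod_le_small; intros e He.
destruct (hol_pow (fun _ => True) _ _ (S n) (hol_id _)) as [g' Hg].
rewrite (mean_const _ g' 0 (rho + 2) rho e); try lra.
2: now apply hol_sub with (2 := Hg).
apply (mean_bound e).
- lra.
- intros w _; exact (hol_continuous _ _ _ _ Hg I).
- intros t _; rewrite Cmod_pow, Cmod_circ by lra; apply pow_le_self; lra.
Qed.

Lemma mean_pow_neg (n : nat) (rho : R) :
  0 < rho -> mean (fun w => ((/ w) ^ S n)%C) rho = RtoC 0.
Proof.
intros Hrho; apply Cmod_le_small; intros e He.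
assert (Hnz : forall w, 0 < Cmod w -> w <> RtoC 0) by (intros w; apply Cmod_gt_0).
destruct (hol_pow (fun w => 0 < Cmod w) _ _ (S n) (hol_inv _ Hnz)) as [g' Hg].
assert (Hie : 0 < / e) by (apply Rinv_0_lt_compat; lra).
(* For negative powers the circle grows instead: at radius [/ e] the integrand is at most [e]. *)
rewrite (mean_const _ g' 0 (rho + / e + 1) rho (/ e)); try lra.
2: { apply hol_sub with (2 := Hg); intros w Hw; lra. }
apply (mean_bound (/ e)).
- lra.
- intros w Hw; apply (hol_continuous _ _ _ _ Hg); lra.
- intros t _; rewrite Cmod_pow, Cmod_inv, Cmod_circ, Rinv_inv by
    (try apply Hnz; rewrite ?Cmod_circ; lra).
  apply pow_le_self; lra.
Qed.

(** * Laurent expansion *)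

(** On the circle dw = i w dt, so this mean is Laurent's integral of f(w) w^(-n-1) dw divided by 2
    pi i. [coefm] is likewise the coefficient of the power -n. *)
Definition coefp (f : C -> C) (r : R) (n : nat) : C := mean (fun w => ((/ w) ^ n * f w)%C) r.
Definition coefm (f : C -> C) (r : R) (n : nat) : C := mean (fun w => (w ^ n * f w)%C) r.

Notation is_Cseries := (@is_series C_AbsRing (AbsRing_NormedModule C_AbsRing)).

Lemma is_Cseries_geom (u : nat -> C) (s : C) (K q : R) :
  0 <= q < 1 ->
  (forall n, Cmod (@sum_n (AbsRing_NormedModule C_AbsRing) u n - s)%C <= K * q ^ n) ->
  is_Cseries u s.
Proof.
intros Hq H.
apply (filterlim_locally (U := CU)); intros eps.
assert (L : is_lim_seq (fun n => K * q ^ n) (K * 0)).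
{ apply (is_lim_seq_scal_l (fun n => q ^ n) K 0), is_lim_seq_geom.
  rewrite Rabs_pos_eq; lra. }
rewrite Rmult_0_r in L; apply is_lim_seq_spec in L.
generalize (L eps); apply filter_imp; intros n Hn.
change (Cmod (@sum_n (AbsRing_NormedModule C_AbsRing) u n - s)%C < eps).
eapply Rle_lt_trans; [apply H|].
rewrite Rminus_0_r in Hn; eapply Rle_lt_trans; [apply Rle_abs | exact Hn].
Qed.

Lemma hol_ext_loc (D : C -> Prop) (f g f' : C -> C) :
  (forall z, D z -> @locally CU z (fun w => g w = f w)) ->
  hol D f f' -> hol D g f'.
Proof.
intros He Hf z Hz; split; [|now apply Hf].
apply cderiv_ext_loc with f; [now apply He | now apply Hf].
Qed.

Lemma locally_neq (z z0 : C) : z <> z0 -> @locally CU z (fun w => w <> z0).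
Proof.
intros Hz; apply locally_CU.
assert (Hp : 0 < Cmod (z0 - z)%C).
{ apply Cmod_gt_0; intros E; apply Hz; symmetry; now apply Ceq_minus. }
exists (mkposreal _ Hp); simpl; intros w Hw ->; lra.
Qed.
(** The coefficients of nonnegative powers are moved to a radius [b] beyond |z0|, the others to a
    radius [a] short of it. The telescoped remainders then decay geometrically, with ratios |z0| / b
    and a / |z0|. *)
Lemma laurent (f f' : C -> C) (R1 R2 r : R) (z0 : C) :
  0 <= R1 -> hol (fun w => R1 < Cmod w < R2) f f' -> R1 < r < R2 ->
  R1 < Cmod z0 < R2 ->
  exists s1 s2 : C,
    is_Cseries (fun n => (z0 ^ n * coefp f r n)%C) s1 /\
    is_Cseries (fun n => ((/ z0) ^ S n * coefm f r (S n))%C) s2 /\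
    f z0 = (s1 + s2)%C.
Proof.
intros H0 Hf Hr Hz0.
set (D := fun w => R1 < Cmod w < R2) in *.
assert (Hnz : forall w, D w -> w <> RtoC 0).
{ intros w [Hw _]; apply Cmod_gt_0; lra. }
destruct (Hf z0 Hz0) as [(phi & Hphi & _ & Hphif) _].
set (kappa := fun w => (w * phi w)%C).
set (r0 := Cmod z0) in *.
(* [f w - f z0 = kappa w - z0 * kappa w / w] makes both partial sums telescope *)
assert (Hk : forall w, D w -> (f w - f z0 = kappa w - z0 * (/ w * kappa w))%C).
{ intros w Hw; rewrite (Hphif w); unfold kappa; field; now apply Hnz. }
assert (Hkc : forall w, D w -> ccont kappa w).
{ intros w Hw; apply ccont_mult; [apply ccont_id|].
  destruct (excluded_middle_informative (w = z0)) as [->|Hn]; [exact Hphi|].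
  apply ccont_ext_loc with (fun v => ((f v - f z0) * / (- z0 + v))%C).
  - generalize (locally_neq _ _ Hn); apply filter_imp; intros v Hv.
    rewrite (Hphif v); field.
    intros E; apply Hv, Ceq_minus; rewrite <- E; ring.
  - apply ccont_mult.
    + apply ccont_minus; [exact (hol_continuous _ _ _ _ Hf Hw) | apply ccont_const].
    + apply (ccont_comp (fun v => (- z0 + v)%C) Cinv).
      * apply ccont_plus; [apply ccont_const | apply ccont_id].
      * apply ccont_inv; intros E; apply Hn, Ceq_minus; rewrite <- E; ring. }
(* The whole circle through [z0] is left out, which yields the two annuli that [mean_const_across]
   joins. *)
assert (Hkh : exists k', hol (fun w => D w /\ Cmod w <> r0) kappa k').
{ set (D' := fun w => D w /\ Cmod w <> r0).
  assert (Hsub : forall w, D' w -> (- z0 + w)%C <> RtoC 0).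
  { intros w [_ Hw] E; apply Hw; unfold r0; f_equal; apply Ceq_minus; rewrite <- E; ring. }
  assert (Hi : hol D' (fun w => / (- z0 + w))%C (fun w => - / ((- z0 + w) * (- z0 + w)))%C).
  { apply hol_sub with (2 := hol_shift _ _ _ (- z0)%C (hol_inv (fun w => w <> RtoC 0) (fun w H => H))).
    exact Hsub. }
  assert (Hfd : hol D' f f') by (apply hol_sub with (2 := Hf); now intros w [Hw _]).
  eexists; apply hol_ext_loc with (fun w => (w * ((f w - f z0) * / (- z0 + w)))%C).
  2: exact (hol_mult _ _ _ _ _ (hol_id _) (hol_mult _ _ _ _ _ (hol_minus _ _ _ _ _ Hfd (hol_const _ (f z0))) Hi)).
  intros w Hw; assert (Hn : w <> z0) by (intros E; apply (proj2 Hw); now rewrite E).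
  generalize (locally_neq _ _ Hn); apply filter_imp; intros v Hv; unfold kappa.
  rewrite (Hphif v); field.
  intros E; apply Hv, Ceq_minus; rewrite <- E; ring. }
destruct Hkh as [k' Hkh].
set (a := (R1 + r0) / 2); set (b := (R2 + r0) / 2).
assert (Ha : R1 < a < r0) by (unfold a; lra).
assert (Hb : r0 < b < R2) by (unfold b; lra).
assert (Ek : mean kappa a = mean kappa b).
{ apply (mean_const_across kappa k' R1 R2 a r0 b); trivial; lra. }
assert (Hpow : forall n, exists g', hol D (fun w => (w ^ n * f w)%C) g').
{ intros n; destruct (hol_pow D _ _ n (hol_id _)) as [g' Hg].
  eexists; exact (hol_mult _ _ _ _ _ Hg Hf). }
assert (Hipow : forall n, exists g', hol D (fun w => ((/ w) ^ n)%C) g').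
{ intros n; exact (hol_pow D _ _ n (hol_inv _ Hnz)). }
assert (Hpowc : forall n w, ccont (fun w => (w ^ n)%C) w).
{ intros n w; apply (@continuous_Cpow CU), ccont_id. }
assert (Hipowc : forall n w, D w -> ccont (fun w => ((/ w) ^ n)%C) w).
{ intros n w Hw; destruct (Hipow n) as [g' Hg]; exact (hol_continuous _ _ _ _ Hg Hw). }
assert (Ecp : forall n, coefp f r n = coefp f b n).
{ intros n; destruct (Hipow n) as [g' Hg].
  apply (mean_const _ _ R1 R2 r b H0 (hol_mult _ _ _ _ _ Hg Hf)); lra. }
assert (Ecm : forall n, coefm f r n = coefm f a n).
{ intros n; destruct (Hpow n) as [g' Hg].
  apply (mean_const _ _ R1 R2 r a H0 Hg); lra. }
assert (Hb' : forall w, Cmod w = b -> D w) by (intros w Hw; unfold D; lra).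
assert (Ha' : forall w, Cmod w = a -> D w) by (intros w Hw; unfold D; lra).
assert (Hz0nz : z0 <> RtoC 0) by (apply Hnz; exact Hz0).
set (P n := mean (fun w => ((/ w) ^ n * kappa w)%C) b).
set (Q n := mean (fun w => (w ^ n * kappa w)%C) a).
(* The constant [f z0] contributes the mean of [w^-n], which is 1 for n = 0 and 0 otherwise. The
   negative side starts at exponent 1 and gets no such term. *)
assert (EP : forall n, coefp f b n = ((match n with O => f z0 | _ => RtoC 0 end) + (P n - z0 * P (S n)))%C).
{ intros n.
  assert (T : mean (fun w => ((/ w) ^ n * f w - f z0 * (/ w) ^ n)%C) b = (P n - z0 * P (S n))%C).
  { unfold P; rewrite <- mean_scal, <- mean_minus.
    - apply mean_ext; [lra|]; intros w Hw; rewrite Cpow_S.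
      replace ((/ w) ^ n * f w - f z0 * (/ w) ^ n)%C with ((/ w) ^ n * (f w - f z0))%C by ring.
      rewrite Hk by auto; ring.
    - lra.
    - intros w Hw; apply ccont_mult; auto.
    - intros w Hw; apply ccont_mult; [apply ccont_const|]; apply ccont_mult; auto.
    - lra.
    - intros w Hw; apply ccont_mult; auto. }
  rewrite <- T, mean_minus, mean_scal; try lra.
  - unfold coefp; destruct n as [|n].
    + rewrite (mean_ext (fun w => ((/ w) ^ 0)%C) (fun _ => RtoC 1) b), mean_const_fun; [ring|lra|reflexivity].
    + rewrite mean_pow_neg by lra; ring.
  - intros w Hw; auto.
  - intros w Hw; apply ccont_mult; auto; exact (hol_continuous _ _ _ _ Hf (Hb' w Hw)).
  - intros w Hw; apply ccont_mult; auto; apply ccont_const. }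
assert (EQ : forall n, coefm f a (S n) = (Q (S n) - z0 * Q n)%C).
{ intros n.
  assert (T : mean (fun w => (w ^ S n * f w - f z0 * w ^ S n)%C) a = (Q (S n) - z0 * Q n)%C).
  { unfold Q; rewrite <- mean_scal, <- mean_minus.
    - apply mean_ext; [lra|]; intros w Hw; rewrite Cpow_S.
      replace (w * w ^ n * f w - f z0 * (w * w ^ n))%C with (w * w ^ n * (f w - f z0))%C by ring.
      rewrite Hk by auto; field; auto.
    - lra.
    - intros w Hw; apply ccont_mult; auto.
    - intros w Hw; apply ccont_mult; [apply ccont_const|]; apply ccont_mult; auto.
    - lra.
    - intros w Hw; apply ccont_mult; auto. }
  rewrite <- T, mean_minus, mean_scal; try lra.
  - unfold coefm; rewrite mean_pow_pos by lra; ring.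
  - intros w Hw; auto.
  - intros w Hw; apply ccont_mult; auto; exact (hol_continuous _ _ _ _ Hf (Ha' w Hw)).
  - intros w Hw; apply ccont_mult; auto; apply ccont_const. }
(* The partial sums are [f z0 + P 0 - z0^(n+1) P (n+1)] and [z0^-(n+1) Q (n+1) - Q 0]. The limits
   add up to [f z0] because [P 0] and [Q 0] are the means of [kappa] at [b] and at [a]. *)
exists (f z0 + P 0%nat)%C, (- Q 0%nat)%C.
assert (Hq1 : 0 <= r0 / b < 1).
{ split; [apply Rdiv_le_0_compat; lra|]. apply Rmult_lt_reg_r with b; [lra|].
  unfold Rdiv; rewrite Rmult_assoc, Rinv_l; lra. }
assert (Hq2 : 0 <= a / r0 < 1).
{ split; [apply Rdiv_le_0_compat; lra|]. apply Rmult_lt_reg_r with r0; [lra|].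
  unfold Rdiv; rewrite Rmult_assoc, Rinv_l; lra. }
destruct (circle_bounded b kappa) as [M HM]; [lra | auto |].
destruct (circle_bounded a kappa) as [M' HM']; [lra | auto |].
assert (BP : forall n, Cmod (P n) <= 2 * ((/ b) ^ n * M)).
{ intros n; apply (mean_bound b (fun w => ((/ w) ^ n * kappa w)%C)); [lra | |].
  - intros w Hw; apply ccont_mult; auto.
  - intros t Ht; assert (Hc : Cmod (circ b t) = b) by (apply Cmod_circ; lra).
    rewrite Cmod_mult, Cmod_pow, Cmod_inv, Hc by auto.
    apply Rmult_le_compat_l; [|now apply HM].
    apply pow_le; left; apply Rinv_0_lt_compat; lra. }
assert (BQ : forall n, Cmod (Q n) <= 2 * (a ^ n * M')).
{ intros n; apply (mean_bound a (fun w => (w ^ n * kappa w)%C)); [lra | |].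
  - intros w Hw; apply ccont_mult; auto.
  - intros t Ht; assert (Hc : Cmod (circ a t) = a) by (apply Cmod_circ; lra).
    rewrite Cmod_mult, Cmod_pow, Hc by auto.
    apply Rmult_le_compat_l; [|now apply HM'].
    apply pow_le; lra. }
split; [|split].
- apply is_Cseries_geom with (K := 2 * M * (r0 / b)) (q := r0 / b); [exact Hq1|].
  intros n.
  assert (E : @eq C (@sum_n (AbsRing_NormedModule C_AbsRing) (fun n => (z0 ^ n * coefp f r n)%C) n)
              (f z0 + P 0%nat - z0 ^ S n * P (S n))%C).
  { induction n as [|n IH].
    - rewrite sum_O, Ecp, EP; simpl Cpow; ring.
    - rewrite sum_Sn, IH, Ecp, EP.
      change (@plus (AbsRing_NormedModule C_AbsRing)) with Cplus.
      rewrite !Cpow_S; ring. }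
  rewrite E.
  replace (f z0 + P 0%nat - z0 ^ S n * P (S n) - (f z0 + P 0%nat))%C
    with (- (z0 ^ S n * P (S n)))%C by ring.
  rewrite Cmod_opp, Cmod_mult, Cmod_pow; fold r0.
  eapply Rle_trans; [apply Rmult_le_compat_l; [apply pow_le; lra | apply BP]|].
  right; unfold Rdiv; rewrite Rpow_mult_distr; simpl; ring.
- apply is_Cseries_geom with (K := 2 * M' * (a / r0)) (q := a / r0); [exact Hq2|].
  intros n.
  assert (E : @eq C (@sum_n (AbsRing_NormedModule C_AbsRing) (fun n => ((/ z0) ^ S n * coefm f r (S n))%C) n)
              ((/ z0) ^ S n * Q (S n) - Q 0%nat)%C).
  { induction n as [|n IH].
    - rewrite sum_O, Ecm, EQ, Cpow_1_r; field; assumption.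
    - rewrite sum_Sn, IH, Ecm, EQ.
      change (@plus (AbsRing_NormedModule C_AbsRing)) with Cplus.
      rewrite (Cpow_S (/ z0) (S n)); field; assumption. }
  rewrite E.
  replace ((/ z0) ^ S n * Q (S n) - Q 0%nat - - Q 0%nat)%C
    with ((/ z0) ^ S n * Q (S n))%C by ring.
  rewrite Cmod_mult, Cmod_pow, Cmod_inv by assumption; fold r0.
  eapply Rle_trans; [apply Rmult_le_compat_l;
    [apply pow_le; left; apply Rinv_0_lt_compat; lra | apply BQ]|].
  right; unfold Rdiv; rewrite Rpow_mult_distr; simpl; ring.
- assert (P 0%nat = Q 0%nat) as ->; [|ring].
  unfold P, Q; symmetry.
  rewrite (mean_ext _ kappa a), (mean_ext _ kappa b); try lra; [exact Ek| |];
    intros w _; simpl; ring.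
Qed.

(** * Propagation of zeros *)

Lemma is_Cseries_zero (u : nat -> C) (s : C) :
  (forall n, u n = RtoC 0) -> is_Cseries u s -> s = RtoC 0.
Proof.
intros Hu Hs.
apply (filterlim_locally_unique (V := AbsRing_NormedModule C_AbsRing) (F := eventually)
  (@sum_n (AbsRing_NormedModule C_AbsRing) u)); [exact Hs|].
apply (@filterlim_ext nat CU eventually _ _ (fun _ => RtoC 0)).
- intros n; induction n as [|n IH].
  + now rewrite sum_O, Hu.
  + rewrite sum_Sn, <- IH, Hu.
    change (RtoC 0 = (RtoC 0 + RtoC 0)%C); ring.
- apply (@filterlim_const nat CU eventually _).
Qed.

(** In the expansion about [c] every coefficient is a mean over a circle of radius less than [d],
    where [f] is 0. The centre is treated apart, as the expansion holds in a punctured disc. *)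
Lemma disc_vanish (f f' : C -> C) (c : C) (R d : R) :
  0 < d -> hol (fun w => Cmod (w - c)%C < R) f f' ->
  (forall w, Cmod (w - c)%C < d -> f w = RtoC 0) ->
  forall z, Cmod (z - c)%C < R -> f z = RtoC 0.
Proof.
intros Hd Hf H0 z Hz.
destruct (excluded_middle_informative (z = c)) as [->|Hzc].
{ apply H0; replace (c - c)%C with (RtoC 0) by ring; now rewrite Cmod_0. }
assert (Hzp : 0 < Cmod (z - c)%C) by now apply Cmod_gt_0, Cminus_eq_contra.
set (r := Rmin d R / 2).
assert (Hr : 0 < r < d /\ r < R).
{ assert (0 < Rmin d R) by (apply Rmin_pos; lra).
  pose proof (Rmin_l d R); pose proof (Rmin_r d R); unfold r; lra. }
destruct (laurent (fun w => f (c + w)%C) (fun w => f' (c + w)%C) 0 R r (z - c)%C)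
  as (s1 & s2 & S1 & S2 & E); [lra | | lra | lra |].
{ apply hol_sub with (2 := hol_shift _ _ _ c Hf); intros w Hw.
  replace (c + w - c)%C with w by ring; lra. }
assert (Hz0 : forall w, Cmod w = r -> f (c + w)%C = RtoC 0).
{ intros w Hw; apply H0; replace (c + w - c)%C with w by ring; lra. }
apply is_Cseries_zero in S1; [apply is_Cseries_zero in S2|].
- replace (c + (z - c))%C with z in E by ring; rewrite E, S1, S2; ring.
- intros n; unfold coefm; rewrite (mean_ext _ (fun _ => RtoC 0)), mean_const_fun; [ring|lra|].
  intros w Hw; rewrite Hz0 by assumption; ring.
- intros n; unfold coefp; rewrite (mean_ext _ (fun _ => RtoC 0)), mean_const_fun; [ring|lra|].
  intros w Hw; rewrite Hz0 by assumption; ring.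
Qed.

(** Continuation along a path: at the supremum of the parameters near which [G] vanishes,
    [disc_vanish] carries vanishing from just before it to just after it. *)
Lemma path_vanish (D : C -> Prop) (G G' : C -> C) (gamma : R -> C) (a b : R) :
  a <= b -> hol D G G' ->
  (forall t, a <= t <= b -> @continuous R_UniformSpace CU gamma t) ->
  (forall t, a <= t <= b -> @locally CU (gamma t) D) ->
  @locally CU (gamma a) (fun w => G w = RtoC 0) ->
  @locally CU (gamma b) (fun w => G w = RtoC 0).
Proof.
intros Hab HG Hc HD Ha.
set (Z t := @locally CU (gamma t) (fun w => G w = RtoC 0)).
assert (step : forall t, a <= t <= b -> exists d : posreal,
  forall s u, a <= s <= b -> Rabs (s - t) < d -> Rabs (u - t) < d -> Z s -> Z u).
{ intros t Ht.
  destruct (proj1 (locally_CU _ _) (HD t Ht)) as [d Hd].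
  (* With [gamma s] and [gamma u] within d/4 of [gamma t], the disc of radius 3d/4 about [gamma s]
     lies in the disc of radius d about [gamma t], hence in [D], and contains the disc of radius d/4
     about [gamma u]. *)
  assert (Hd4 : 0 < d / 4) by (destruct d; simpl; lra).
  destruct (proj1 (continuous_C_iff gamma t) (Hc t Ht) (mkposreal _ Hd4)) as [e He].
  exists e; intros s u Hs Hst Hut Zs.
  assert (Gs := He s Hst); assert (Gu := He u Hut); simpl in Gs, Gu.
  destruct (proj1 (locally_CU _ _) Zs) as [d' Hd'].
  assert (Hdz : forall w, Cmod (w - gamma s)%C < d / 2 + d / 4 -> G w = RtoC 0).
  { apply (disc_vanish G G' (gamma s) (d / 2 + d / 4) d' (cond_pos d')); [|exact Hd'].
    apply hol_sub with (2 := HG); intros w Hw; apply Hd.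
    replace (w - gamma t)%C with ((w - gamma s) + (gamma s - gamma t))%C by ring.
    eapply Rle_lt_trans; [apply Cmod_triangle | lra]. }
  apply locally_CU; exists (mkposreal _ Hd4); simpl; intros w Hw; apply Hdz.
  replace (w - gamma s)%C with ((w - gamma u) + ((gamma u - gamma t) - (gamma s - gamma t)))%C by ring.
  eapply Rle_lt_trans; [apply Cmod_triangle|].
  assert (T := Cmod_triangle (gamma u - gamma t)%C (- (gamma s - gamma t))%C).
  rewrite Cmod_opp in T; unfold Cminus at 2; lra. }
destruct (completeness (fun t => a <= t <= b /\ Z t)) as [T [HT1 HT2]].
- exists b; intros t [Ht _]; lra.
- exists a; split; [lra | exact Ha].
- assert (HTab : a <= T <= b).
  { split; [apply HT1; split; [lra|exact Ha] | apply HT2; intros t [Ht _]; lra]. }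
  destruct (step T HTab) as [d Hd].
  assert (Hs : exists s, a <= s <= b /\ Rabs (s - T) < d /\ Z s).
  { apply Classical_Prop.NNPP; intros Hn.
    assert (Hu : T <= T - d).
    { apply HT2; intros t [Ht Zt]; apply Rnot_lt_le; intros Hlt; apply Hn.
      exists t; split; [exact Ht|split; [|exact Zt]].
      assert (t <= T) by (apply HT1; split; assumption).
      apply Rabs_def1; destruct d; simpl in *; lra. }
    destruct d; simpl in *; lra. }
  destruct Hs as (s & Hsab & HsT & Zs).
  destruct (Rle_or_lt b (T + d / 2)) as [Hb|Hb].
  + apply (Hd s b Hsab HsT); [|exact Zs].
    apply Rabs_def1; destruct d; simpl in *; lra.
  + exfalso.
    assert (Zn : Z (T + d / 2)).
    { apply (Hd s _ Hsab HsT); [|exact Zs].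
      apply Rabs_def1; destruct d; simpl in *; lra. }
    assert (T + d / 2 <= T); [apply HT1; split; [destruct d; simpl in *; lra | exact Zn]|].
    destruct d; simpl in *; lra.
Qed.

(** * Cutting off below the real axis *)

Lemma cderiv_zero_on_reals (S : C -> Prop) (h : C -> C) (z : C) (phi : C -> C) :
  @locally CU z S -> Im z = 0 -> (forall w, S w -> Im w = 0 -> h w = RtoC 0) ->
  ccont phi z -> (forall w, h w = (h z + phi w * (w - z))%C) -> phi z = RtoC 0.
Proof.
intros HS Hz Hh Hphi Hf.
destruct (excluded_middle_informative (phi z = RtoC 0)) as [E|Hn]; [exact E|exfalso].
assert (Hp : 0 < Cmod (phi z)) by now apply Cmod_gt_0.
assert (L := proj1 (@continuous_C_iff CU phi z) Hphi (mkposreal _ Hp)).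
destruct (proj1 (locally_CU _ _) (filter_and _ _ HS L)) as [d Hd]; simpl in Hd.
assert (Hd0 := cond_pos d).
(* A second real point: the difference quotient there is 0, while [Cw] puts it at distance less than
   |phi z| from [phi z]. *)
set (w := (z + RtoC (d / 2))%C).
assert (Ewz : (w - z)%C = RtoC (d / 2)) by (unfold w; ring).
destruct (Hd w) as [Sw Cw].
{ rewrite Ewz, Cmod_R, Rabs_pos_eq; lra. }
assert (Hw0 : h w = RtoC 0).
{ apply Hh; [exact Sw|]; unfold w; destruct z; unfold Im in *; simpl in *; lra. }
assert (Hz0 : h z = RtoC 0) by (apply Hh; [exact (locally_singleton _ _ HS) | exact Hz]).
assert (P0 : phi w = RtoC 0).
{ assert (E := Hf w); rewrite Hw0, Hz0, Ewz in E.
  replace (phi w) with ((0 + phi w * RtoC (d / 2)) * / RtoC (d / 2))%C.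
  - rewrite <- E; ring.
  - field; intros E2; apply RtoC_inj in E2; lra. }
rewrite P0 in Cw; replace (0 - phi z)%C with (- phi z)%C in Cw by ring.
rewrite Cmod_opp in Cw; lra.
Qed.

Definition upper_part (h : C -> C) (w : C) : C :=
  if Rlt_dec 0 (Im w) then h w else RtoC 0.

Lemma locally_Im_pos (z : C) : 0 < Im z -> @locally CU z (fun w => 0 < Im w).
Proof. intros Hz; exact (continuous_Im z _ (open_gt 0 _ Hz)). Qed.

Lemma locally_Im_neg (z : C) : Im z < 0 -> @locally CU z (fun w => Im w < 0).
Proof. intros Hz; exact (continuous_Im z _ (open_lt 0 _ Hz)). Qed.

Lemma upper_part_pos (h : C -> C) (z : C) :
  0 < Im z -> @locally CU z (fun w => h w = upper_part h w).
Proof.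
intros Hz; generalize (locally_Im_pos z Hz); apply filter_imp; intros w Hw.
unfold upper_part; destruct (Rlt_dec _ _); [reflexivity | contradiction].
Qed.

Lemma upper_part_neg (h : C -> C) (z : C) :
  Im z < 0 -> @locally CU z (fun w => RtoC 0 = upper_part h w).
Proof.
intros Hz; generalize (locally_Im_neg z Hz); apply filter_imp; intros w Hw.
unfold upper_part; destruct (Rlt_dec _ _); [lra | reflexivity].
Qed.

Lemma ccont_upper_part (h : C -> C) (z : C) :
  ccont h z -> h z = RtoC 0 -> ccont (upper_part h) z.
Proof.
intros Hh Hz; apply (@continuous_C_iff CU); intros eps.
generalize (proj1 (@continuous_C_iff CU h z) Hh eps); apply filter_imp.
intros w Hw.
assert (upper_part h z = RtoC 0) as ->.
{ unfold upper_part; destruct (Rlt_dec _ _); trivial. }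
rewrite Hz in Hw; unfold upper_part; destruct (Rlt_dec _ _); [exact Hw|].
replace (0 - 0)%C with (RtoC 0) by ring; rewrite Cmod_0; apply cond_pos.
Qed.

(* [h] vanishes with its derivative on the real axis, so cutting it off below
   the axis keeps it holomorphic. *)
Lemma hol_upper_part (S : C -> Prop) (h h' : C -> C) :
  (forall z, S z -> @locally CU z S) -> hol S h h' ->
  (forall w, S w -> Im w = 0 -> h w = RtoC 0) ->
  hol S (upper_part h) (upper_part h').
Proof.
intros HS Hh H0 z Hz; destruct (Hh z Hz) as [Hd Hc].
destruct (total_order_T (Im z) 0) as [[Hn|He]|Hp].
- split.
  + replace (upper_part h' z) with (RtoC 0) by exact (locally_singleton _ _ (upper_part_neg h' z Hn)).
    apply cderiv_ext_loc with (fun _ => RtoC 0); [|apply cderiv_const].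
    generalize (upper_part_neg h z Hn); apply filter_imp; now intros w ->.
  + apply ccont_ext_loc with (fun _ => RtoC 0); [|apply ccont_const].
    exact (upper_part_neg h' z Hn).
- destruct Hd as (phi & Hphi & Hl & Hf).
  assert (Hphi0 : phi z = RtoC 0) by exact (cderiv_zero_on_reals S h z phi (HS z Hz) He H0 Hphi Hf).
  split.
  (* As [h z] and [phi z] are both 0, cutting off the factor preserves its equation on both sides of
     the axis and its continuity at [z]. *)
  + exists (upper_part phi); split; [now apply ccont_upper_part|split].
    * unfold upper_part; destruct (Rlt_dec _ _); trivial.
    * intros w; unfold upper_part.
      destruct (Rlt_dec 0 (Im z)) as [Hz'|_]; [lra|].
      destruct (Rlt_dec 0 (Im w)); [|ring].
      rewrite (Hf w), (H0 z Hz He); reflexivity.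
  + apply ccont_upper_part; [exact Hc | now rewrite <- Hl].
- split.
  + replace (upper_part h' z) with (h' z) by exact (locally_singleton _ _ (upper_part_pos h' z Hp)).
    apply cderiv_ext_loc with h; [|exact Hd].
    generalize (upper_part_pos h z Hp); apply filter_imp; now intros w ->.
  + apply ccont_ext_loc with h'; [|exact Hc].
    exact (upper_part_pos h' z Hp).
Qed.

(** * The lens and its elliptic arcs *)

Lemma locally_annulus (p z : C) (R1 R2 : R) :
  R1 < Cmod (z - p)%C < R2 ->
  @locally CU z (fun w => R1 < Cmod (w - p)%C < R2).
Proof.
intros [H1 H2].
assert (Hd : 0 < Rmin (Cmod (z - p)%C - R1) (R2 - Cmod (z - p)%C)) by (apply Rmin_pos; lra).
apply locally_CU; exists (mkposreal _ Hd); simpl; intros w Hw.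
pose proof (Rmin_l (Cmod (z - p)%C - R1) (R2 - Cmod (z - p)%C)).
pose proof (Rmin_r (Cmod (z - p)%C - R1) (R2 - Cmod (z - p)%C)).
assert (T1 := Cmod_triangle (w - z)%C (z - p)%C).
assert (T2 := Cmod_triangle (- (w - z))%C (w - p)%C).
rewrite Cmod_opp in T2.
replace (w - z + (z - p))%C with (w - p)%C in T1 by ring.
replace (- (w - z) + (w - p))%C with (z - p)%C in T2 by ring.
lra.
Qed.

(** The intersection of the annulus about p = x0 + i y0 with its mirror image in the real axis: the
    distance from z to the conjugate of p is that from the conjugate of z to p. *)
Definition lens (x0 y0 R1 R2 : R) (z : C) : Prop :=
  R1 < Cmod (z - (x0, y0))%C < R2 /\ R1 < Cmod (z - (x0, (- y0)%R))%C < R2.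

Lemma locally_lens (x0 y0 R1 R2 : R) (z : C) :
  lens x0 y0 R1 R2 z -> @locally CU z (lens x0 y0 R1 R2).
Proof. intros [H1 H2]; apply filter_and; now apply locally_annulus. Qed.

Lemma Cmod_eq_sqr (z : C) (r : R) :
  0 <= r -> Re z ^ 2 + Im z ^ 2 = r ^ 2 -> Cmod z = r.
Proof.
intros Hr H; unfold Cmod; change (sqrt (Re z ^ 2 + Im z ^ 2) = r).
rewrite H; now apply sqrt_pow2.
Qed.

(* The ellipse with foci [x0 +- i y0] through [z] leads from [z] to its
   conjugate: along it the distances to the foci are [a -+ y0 t], with
   [a t] the imaginary part, so it stays in the lens. *)
Lemma lens_path (x0 y0 R1 R2 : R) (z : C) :
  0 <= y0 -> 0 <= R1 -> lens x0 y0 R1 R2 z -> 0 < Im z ->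
  exists (gamma : R -> C) (c : R), 0 < c /\
    (forall t, @continuous R_UniformSpace CU gamma t) /\
    (forall t, - c <= t <= c -> lens x0 y0 R1 R2 (gamma t)) /\
    Im (gamma (- c)) < 0 /\ gamma c = z.
Proof.
intros Hy0 HR1 [[H1 H2] [H3 H4]] Hy.
set (d1 := Cmod (z - (x0, y0))%C) in *; set (d2 := Cmod (z - (x0, (- y0)%R))%C) in *.
assert (E1 : d1 ^ 2 = (Re z - x0) ^ 2 + (Im z - y0) ^ 2) by apply Cmod2_alt.
assert (E2 : d2 ^ 2 = (Re z - x0) ^ 2 + (Im z + y0) ^ 2).
{ unfold d2; rewrite Cmod2_alt; destruct z; unfold Re, Im; simpl; ring. }
assert (zE : z = (Re z, Im z)) by (destruct z; reflexivity).
set (y := Im z) in *; set (u := Re z - x0) in *.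
(* The semi-major axis, vertical like the line of the foci. Averaging [B3] with [B1] and with [B2]
   gives [y0 <= a] and [y <= a]. *)
set (a := (d1 + d2) / 2).
assert (B1 : y0 - y <= d1) by nra.
assert (B2 : y - y0 <= d1) by nra.
assert (B3 : y + y0 <= d2) by nra.
assert (Ha : 0 < a /\ y <= a /\ y0 <= a) by (unfold a; lra).
set (c := y / a).
assert (Hca : a * c = y) by (unfold c; field; lra).
assert (Hc : 0 < c <= 1).
{ split; [apply Rdiv_lt_0_compat; lra|].
  apply Rmult_le_reg_l with a; lra. }
(* Dividing d2^2 - d1^2 = 4 y0 y by d1 + d2 = 2 a gives the difference of the focal distances. *)
assert (Hd : d2 = a + y0 * c).
{ assert (T : (d2 - d1) * (2 * a) = 4 * (y0 * y)) by (unfold a; nra).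
  rewrite <- Hca in T.
  assert (d2 - d1 = 2 * (y0 * c)).
  { apply Rmult_eq_reg_r with (2 * a); [rewrite T; ring | lra]. }
  unfold a in *; lra. }
assert (Hd' : d1 = a - y0 * c) by (unfold a in *; lra).
set (b := sqrt (a ^ 2 - y0 ^ 2)).
assert (Hb : b ^ 2 = a ^ 2 - y0 ^ 2) by (unfold b; apply pow2_sqrt; nra).
assert (Hu : u ^ 2 = b ^ 2 * (1 - c ^ 2)).
{ rewrite Hb; rewrite Hd in E2; rewrite <- Hca in E2; nra. }
assert (Hb0 : 0 <= b) by apply sqrt_pos.
(* [b] is the horizontal semi-axis; the sign of [B] selects the half of the ellipse on which [z]
   lies. *)
assert (Hbs : exists B, B ^ 2 = b ^ 2 /\ B * sqrt (1 - c ^ 2) = u).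
{ assert (Hs : (b * sqrt (1 - c ^ 2)) ^ 2 = u ^ 2).
  { rewrite Rpow_mult_distr, pow2_sqrt by nra; lra. }
  assert (Hs0 : 0 <= b * sqrt (1 - c ^ 2)) by (apply Rmult_le_pos; [exact Hb0 | apply sqrt_pos]).
  destruct (Rle_or_lt 0 u) as [Hu0|Hu0].
  - exists b; split; [reflexivity | nra].
  - exists (- b); split; [ring | nra]. }
destruct Hbs as (B & HB & HBu).
exists (fun t => (x0 + B * sqrt (1 - t ^ 2), a * t)), c.
split; [lra|split; [|split; [|split]]].
- intros t; apply (@continuous_Cpair R_UniformSpace).
  + apply (continuous_plus (V := R_NormedModule) (fun _ : R_UniformSpace => x0)); [apply continuous_const|].
    apply (continuous_mult (K := R_AbsRing) (fun _ : R_UniformSpace => B)); [apply continuous_const|].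
    apply (continuous_comp (fun t : R => 1 - t ^ 2) sqrt); [|apply continuous_sqrt].
    apply (ex_derive_continuous (V := R_NormedModule)); auto_derive; trivial.
  + apply (ex_derive_continuous (V := R_NormedModule)); auto_derive; trivial.
(* For |t| <= c both focal distances [a - y0 * t] and [a + y0 * t] stay between [d1] and [d2], the
   values at [z]. *)
- intros t Ht.
  assert (Hsq : sqrt (1 - t ^ 2) ^ 2 = 1 - t ^ 2) by (apply pow2_sqrt; nra).
  set (s := sqrt (1 - t ^ 2)) in *.
  assert (Hyt : - (y0 * c) <= y0 * t <= y0 * c) by nra.
  assert (HBt : (B * s) ^ 2 = (a ^ 2 - y0 ^ 2) * (1 - t ^ 2))
    by (rewrite Rpow_mult_distr, Hsq, HB, Hb; reflexivity).
  split.
  + assert (Cmod ((x0 + B * s, a * t)%R - (x0, y0))%C = a - y0 * t) as ->; [|lra].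
    apply Cmod_eq_sqr; [nra|]; unfold Re, Im; simpl fst; simpl snd.
    transitivity ((B * s) ^ 2 + (a * t - y0) ^ 2); [ring|].
    rewrite HBt; ring.
  + assert (Cmod ((x0 + B * s, a * t)%R - (x0, (- y0)%R))%C = a + y0 * t) as ->; [|lra].
    apply Cmod_eq_sqr; [nra|]; unfold Re, Im; simpl fst; simpl snd.
    transitivity ((B * s) ^ 2 + (a * t + y0) ^ 2); [ring|].
    rewrite HBt; ring.
- unfold Im; simpl; lra.
- rewrite HBu, Hca, zE; f_equal; unfold u; ring.
Qed.

(** [upper_part h] is identically 0 around the lower end of the arc and equals [h] around the upper
    end, so continuation along the arc applies to it. *)
Lemma lens_vanish (h h' : C -> C) (x0 y0 R1 R2 : R) :
  0 <= y0 -> 0 <= R1 -> hol (lens x0 y0 R1 R2) h h' ->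
  (forall z, lens x0 y0 R1 R2 z -> Im z = 0 -> h z = RtoC 0) ->
  forall z, lens x0 y0 R1 R2 z -> 0 <= Im z -> h z = RtoC 0.
Proof.
intros Hy0 HR1 Hh H0 z Hz [Hpos|Hre]; [|apply H0; [exact Hz | now symmetry]].
destruct (lens_path x0 y0 R1 R2 z Hy0 HR1 Hz Hpos) as (gamma & c & Hc & Hcont & Hin & Hneg & Hend).
assert (L : @locally CU (gamma c) (fun w => upper_part h w = RtoC 0)).
{ apply (path_vanish (lens x0 y0 R1 R2) _ (upper_part h') gamma (- c) c); [lra | | auto | |].
  - apply hol_upper_part; trivial; intros w Hw; now apply locally_lens.
  - intros t Ht; apply locally_lens, Hin, Ht.
  - generalize (upper_part_neg h _ Hneg); apply filter_imp; intros w Hw; now symmetry. }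
rewrite Hend in L; rewrite <- (locally_singleton _ _ L).
exact (locally_singleton _ _ (upper_part_pos h z Hpos)).
Qed.

(** * Quaternions and regular functions *)

Definition qdot (m q : quat) : R :=
  let '(a1, b1, c1, d1) := m in
  let '(a2, b2, c2, d2) := q in
  a1 * a2 + b1 * b2 + c1 * c2 + d1 * d2.

Ltac quat_unfold :=
  repeat (unfold mult, one, plus, opp, minus, zero, scal, qmult, quat_of_R, qconj, qdot, qre,
    prod_plus, prod_opp, prod_zero, prod_scal; simpl).

Ltac quat_destruct :=
  repeat match goal with q : quat |- _ => destruct q as [[[? ?] ?] ?] end.

Ltac quat_auto :=
  intros; quat_destruct; quat_unfold; repeat apply (f_equal2 pair); ring.

Lemma qdot_plus_r (m p q : quat) : qdot m (p + q)%H = qdot m p + qdot m q.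
Proof. quat_auto. Qed.

Lemma qdot_opp_l (m q : quat) : qdot (- m)%H q = - qdot m q.
Proof. quat_auto. Qed.

Lemma qdot_scal_r (m q : quat) (k : R) : qdot m (scal k q) = k * qdot m q.
Proof. quat_auto. Qed.

Lemma qdot_mult_r (m c q : quat) : qdot m (c * q)%H = qdot (qconj c * m)%H q.
Proof. quat_auto. Qed.

Lemma qdot_ext (p q : quat) : (forall m, qdot m p = qdot m q) -> p = q.
Proof.
intros H.
assert (H1 := H (1, 0, 0, 0)); assert (H2 := H (0, 1, 0, 0));
assert (H3 := H (0, 0, 1, 0)); assert (H4 := H (0, 0, 0, 1)).
quat_destruct; unfold qdot in *.
repeat apply (f_equal2 pair); lra.
Qed.

Lemma coord_le_norm (a b c d : R) :
  Rabs a <= qnorm (a, b, c, d) /\ Rabs b <= qnorm (a, b, c, d) /\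
  Rabs c <= qnorm (a, b, c, d) /\ Rabs d <= qnorm (a, b, c, d).
Proof.
unfold qnorm.
assert (H : forall x s, x ^ 2 <= s -> Rabs x <= sqrt s).
{ intros x s Hx; rewrite <- (sqrt_pow2 (Rabs x)) by apply Rabs_pos.
  rewrite pow2_abs; now apply sqrt_le_1_alt. }
repeat split; apply H; nra.
Qed.

Lemma is_linear_qdot (m : quat) :
  @is_linear R_AbsRing quat_NormedModule R_NormedModule (qdot m).
Proof.
split.
- intros x y; apply qdot_plus_r.
- intros k x; apply qdot_scal_r.
- destruct m as [[[a b] c] d].
  exists (Rabs a + Rabs b + Rabs c + Rabs d + 1); split.
  { pose proof (Rabs_pos a); pose proof (Rabs_pos b); pose proof (Rabs_pos c); pose proof (Rabs_pos d); lra. }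
  intros q.
  change (Rabs (qdot (a, b, c, d) q) <= (Rabs a + Rabs b + Rabs c + Rabs d + 1) * @norm _ quat_NormedModule q).
  rewrite norm_quat; destruct q as [[[x y] z] t].
  destruct (coord_le_norm x y z t) as (H1 & H2 & H3 & H4).
  set (N := qnorm (x, y, z, t)) in *; unfold qdot.
  eapply Rle_trans; [apply Rabs_triang|].
  eapply Rle_trans; [apply Rplus_le_compat_r, Rabs_triang|].
  eapply Rle_trans; [apply Rplus_le_compat_r, Rplus_le_compat_r, Rabs_triang|].
  rewrite !Rabs_mult.
  assert (HN : 0 <= N) by (pose proof (Rabs_pos x); lra).
  pose proof (Rmult_le_compat_l _ _ _ (Rabs_pos a) H1);
  pose proof (Rmult_le_compat_l _ _ _ (Rabs_pos b) H2);
  pose proof (Rmult_le_compat_l _ _ _ (Rabs_pos c) H3);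
  pose proof (Rmult_le_compat_l _ _ _ (Rabs_pos d) H4); lra.
Qed.

Lemma is_derive_qdot (m : quat) (F : R -> quat) (x : R) (l : quat) :
  is_derive F x l -> is_derive (fun t => qdot m (F t)) x (qdot m l).
Proof.
intros HF.
assert (H := filterdiff_comp' F (qdot m) x _ (qdot m) HF
   (filterdiff_linear (qdot m) (is_linear_qdot m))).
apply (filterdiff_ext_lin _ _ _ H); intros y; apply qdot_scal_r.
Qed.

Lemma continuous_qdot (m : quat) {T : UniformSpace} (F : T -> quat) (x : T) :
  continuous F x -> continuous (fun t => qdot m (F t)) x.
Proof.
intros HF; apply (continuous_comp F (qdot m) x HF).
apply (linear_cont (U := quat_NormedModule) (V := R_NormedModule)), is_linear_qdot.
Qed.

Lemma imag_unit_coords (J : quat) :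
  imag_unit J <-> exists b c d, J = (0, b, c, d) /\ b ^ 2 + c ^ 2 + d ^ 2 = 1.
Proof.
destruct J as [[[a b] c] d]; unfold imag_unit; split.
- intros H; revert H; quat_unfold; intros H; injection H; intros H4 H3 H2 H1.
  assert (Ha : a = 0).
  { destruct (Req_dec a 0) as [E|E]; [exact E|exfalso].
    assert (b = 0) by nra; assert (c = 0) by nra; assert (d = 0) by nra; subst; nra. }
  subst a; exists b, c, d; split; [reflexivity | nra].
- intros (b' & c' & d' & E & H); injection E; intros -> -> -> ->.
  quat_unfold; repeat apply (f_equal2 pair); nra.
Qed.

Lemma qconj_imag_unit (J : quat) : imag_unit J -> qconj J = (- J)%H.
Proof.
intros HJ; apply imag_unit_coords in HJ; destruct HJ as (b & c & d & -> & _).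
quat_auto.
Qed.

Lemma imag_unit_sqr (J q : quat) : imag_unit J -> (J * (J * q))%H = (- q)%H.
Proof.
intros HJ; rewrite mult_assoc; unfold imag_unit in HJ; rewrite HJ.
clear HJ J; quat_auto.
Qed.

Lemma imag_unit_opp (J : quat) : imag_unit J -> imag_unit (- J)%H.
Proof.
unfold imag_unit; intros HJ; rewrite <- HJ; clear HJ; quat_auto.
Qed.

(** The functional with real part [qdot m] that is complex linear when i acts by left multiplication
    by [I]; see [lam_mult]. Its real parts, as [m] varies, determine [q]. *)
Definition lam (I m q : quat) : C := (qdot m q, qdot (I * m)%H q).

Definition qC (I : quat) (z : C) : quat := slice I (Re z) (Im z).

Lemma qC_mult (I : quat) (z w : C) :
  imag_unit I -> qC I (z * w)%C = (qC I z * qC I w)%H.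
Proof.
intros HI; apply imag_unit_coords in HI; destruct HI as (b & c & d & -> & H).
destruct z as [x y], w as [u v].
unfold qC, slice, Re, Im; simpl fst; simpl snd; quat_unfold.
repeat apply (f_equal2 pair); try ring.
transitivity (x * u - y * v * (b ^ 2 + c ^ 2 + d ^ 2)); [rewrite H|]; ring.
Qed.

Lemma qC_minus (I : quat) (z w : C) : qC I (z - w)%C = (qC I z - qC I w)%H.
Proof.
destruct z as [x y], w as [u v]; unfold qC, slice, Re, Im; simpl fst; simpl snd.
quat_auto.
Qed.

Lemma qC_pow (I : quat) (z : C) (n : nat) :
  imag_unit I -> qC I (z ^ n)%C = (qC I z ^ n)%H.
Proof.
intros HI; induction n as [|n IH].
- unfold qC, slice, Re, Im; simpl; quat_auto.
- rewrite Cpow_S, qC_mult, IH by assumption; reflexivity.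
Qed.

Lemma qC_inv (I : quat) (z : C) : imag_unit I -> qC I (/ z)%C = qinv (qC I z).
Proof.
intros HI; apply imag_unit_coords in HI; destruct HI as (b & c & d & -> & H).
destruct z as [x y]; unfold qinv.
assert (E : qnorm (qC (0, b, c, d) (x, y)) ^ 2 = x ^ 2 + y ^ 2).
{ unfold qnorm, qC, slice, Re, Im; simpl fst; simpl snd; quat_unfold.
  match goal with |- sqrt ?s * (sqrt ?s * 1) = _ =>
    transitivity (sqrt s ^ 2); [simpl; ring|]; replace s with (x ^ 2 + y ^ 2) end.
  - apply pow2_sqrt; nra.
  - transitivity (x ^ 2 + y ^ 2 * (b ^ 2 + c ^ 2 + d ^ 2)); [rewrite H|]; ring. }
rewrite E; unfold qC, slice, Cinv, Re, Im; simpl fst; simpl snd; quat_unfold.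
repeat apply (f_equal2 pair); unfold Rdiv; ring.
Qed.

Lemma lam_mult (I m q : quat) (z : C) :
  imag_unit I -> lam I m (qC I z * q)%H = (z * lam I m q)%C.
Proof.
intros HI.
assert (H1 : forall n, qdot n (qC I z * q)%H = Re z * qdot n q - Im z * qdot (I * n)%H q).
{ intros n; rewrite qdot_mult_r.
  apply imag_unit_coords in HI; destruct HI as (b & c & d & -> & _).
  destruct z as [x y]; unfold qC, slice, Re, Im; simpl fst; simpl snd; quat_auto. }
unfold lam; rewrite !H1, imag_unit_sqr, qdot_opp_l by assumption.
destruct z as [x y]; apply C_ext; unfold Re, Im; simpl; ring.
Qed.

(** * From the Cauchy-Riemann equations to complex differentiability *)

Lemma mean_value_increment (v v' : R -> R) (a b l e d : R) :
  (forall t, Rabs (t - a) < d -> is_derive v t (v' t)) ->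
  (forall t, Rabs (t - a) < d -> Rabs (v' t - l) <= e) ->
  Rabs (b - a) < d ->
  Rabs (v b - v a - l * (b - a)) <= e * Rabs (b - a).
Proof.
intros Hd He Hb.
assert (Hin : forall t, Rmin a b <= t <= Rmax a b -> Rabs (t - a) < d).
{ intros t Ht; apply Rle_lt_trans with (2 := Hb).
  revert Ht; unfold Rmin, Rmax, Rabs; destruct (Rle_dec a b), (Rcase_abs (t - a)), (Rcase_abs (b - a)); lra. }
destruct (MVT_gen v a b v') as (c & Hc & E).
- intros t Ht; apply Hd, Hin; lra.
- intros t Ht; apply continuity_pt_filterlim.
  apply (ex_derive_continuous v); eexists; apply Hd, Hin, Ht.
- rewrite E; replace (v' c * (b - a) - l * (b - a)) with ((v' c - l) * (b - a)) by ring.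
  rewrite Rabs_mult; apply Rmult_le_compat_r; [apply Rabs_pos | apply He, Hin, Hc].
Qed.

(** The increment is split at the corner (x, b), and each piece is a one-variable mean value
    estimate. *)
Lemma C1_increment (u ux uy : R -> R -> R) (x y : R) :
  locally_2d (fun a b => is_derive (fun t => u t b) a (ux a b) /\
                         is_derive (fun t => u a t) b (uy a b)) x y ->
  continuity_2d_pt ux x y -> continuity_2d_pt uy x y ->
  forall eps : posreal, locally_2d (fun a b =>
    Rabs (u a b - u x y - (ux x y * (a - x) + uy x y * (b - y)))
    <= eps * (Rabs (a - x) + Rabs (b - y))) x y.
Proof.
intros [d0 Hd] Hcx Hcy eps.
destruct (Hcx eps) as [d1 H1]; destruct (Hcy eps) as [d2 H2].
assert (Hm : 0 < Rmin d0 (Rmin d1 d2)) by (repeat apply Rmin_pos; apply cond_pos).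
assert (L0 := Rmin_l d0 (Rmin d1 d2)); assert (L := Rmin_r d0 (Rmin d1 d2)).
assert (L1 := Rmin_l d1 d2); assert (L2 := Rmin_r d1 d2).
exists (mkposreal _ Hm); simpl; intros a b Ha Hb.
set (m := Rmin d0 (Rmin d1 d2)) in *.
assert (Q : Rabs (x - x) < m) by (rewrite Rminus_eq_0, Rabs_R0; exact Hm).
assert (Ex := mean_value_increment (fun t => u t b) (fun t => ux t b) x a (ux x y) eps m).
assert (Ey := mean_value_increment (fun t => u x t) (fun t => uy x t) y b (uy x y) eps m).
replace (u a b - u x y - (ux x y * (a - x) + uy x y * (b - y)))
  with ((u a b - u x b - ux x y * (a - x)) + (u x b - u x y - uy x y * (b - y))) by ring.
eapply Rle_trans; [apply Rabs_triang|].
rewrite Rmult_plus_distr_l; apply Rplus_le_compat; [apply Ex | apply Ey]; trivial.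
- intros t Ht; apply Hd; lra.
- intros t Ht; left; apply H1; lra.
- intros t Ht; apply Hd; lra.
- intros t Ht; left; apply H2; lra.
Qed.

(* The Cauchy-Riemann equations turn the two real differentials into the
   multiplication by [(ux, vx)]. *)
Lemma cderiv_CR (u v ux uy vx vy : R -> R -> R) (z : C) :
  locally_2d (fun a b => is_derive (fun t => u t b) a (ux a b) /\
                         is_derive (fun t => u a t) b (uy a b)) (Re z) (Im z) ->
  locally_2d (fun a b => is_derive (fun t => v t b) a (vx a b) /\
                         is_derive (fun t => v a t) b (vy a b)) (Re z) (Im z) ->
  continuity_2d_pt ux (Re z) (Im z) -> continuity_2d_pt uy (Re z) (Im z) ->
  continuity_2d_pt vx (Re z) (Im z) -> continuity_2d_pt vy (Re z) (Im z) ->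
  ux (Re z) (Im z) = vy (Re z) (Im z) -> uy (Re z) (Im z) = - vx (Re z) (Im z) ->
  cderiv (fun w => (u (Re w) (Im w), v (Re w) (Im w))) z
         (ux (Re z) (Im z), vx (Re z) (Im z)).
Proof.
intros Hu Hv Hux Huy Hvx Hvy CR1 CR2.
set (g := fun w : C => (u (Re w) (Im w), v (Re w) (Im w)) : C).
set (l := (ux (Re z) (Im z), vx (Re z) (Im z)) : C).
exists (fun w => if excluded_middle_informative (w = z) then l else ((g w - g z) / (w - z))%C).
split; [|split].
- apply (@continuous_C_iff CU); intros eps.
  destruct (excluded_middle_informative (z = z)) as [_|N]; [|now elim N].
  (* Real and imaginary errors are each at most eps/5 times 2 |w - z|, so their sum stays strictly
     below eps |w - z|. *)
  assert (He : 0 < eps / 5) by (pose proof (cond_pos eps); lra).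
  destruct (C1_increment u ux uy _ _ Hu Hux Huy (mkposreal _ He)) as [d1 H1].
  destruct (C1_increment v vx vy _ _ Hv Hvx Hvy (mkposreal _ He)) as [d2 H2].
  simpl in H1, H2.
  assert (Hm : 0 < Rmin d1 d2) by (apply Rmin_pos; apply cond_pos).
  apply locally_CU; exists (mkposreal _ Hm); simpl; intros w Hw.
  assert (Lr := re_le_Cmod (w - z)%C); assert (Li := abs_Im_le_Cmod (w - z)%C).
  rewrite Re_minus in Lr; rewrite Im_minus in Li.
  assert (L1 := Rmin_l d1 d2); assert (L2 := Rmin_r d1 d2).
  destruct (excluded_middle_informative (w = z)) as [_|N].
  { replace (l - l)%C with (RtoC 0) by ring; rewrite Cmod_0; apply cond_pos. }
  assert (Hp : 0 < Cmod (w - z)%C) by now apply Cmod_gt_0, Cminus_eq_contra.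
  replace ((g w - g z) / (w - z) - l)%C with ((g w - g z - l * (w - z)) / (w - z))%C
    by (field; now apply Cminus_eq_contra).
  rewrite Cmod_div by now apply Cminus_eq_contra.
  apply Rmult_lt_reg_r with (Cmod (w - z)%C); [exact Hp|].
  unfold Rdiv; rewrite Rmult_assoc, Rinv_l, Rmult_1_r by lra.
  eapply Rle_lt_trans; [apply Cmod_le_abs|].
  specialize (H1 (Re w) (Im w)); specialize (H2 (Re w) (Im w)).
  rewrite CR2 in H1; rewrite <- CR1 in H2.
  replace (Re (g w - g z - l * (w - z))%C) with
    (u (Re w) (Im w) - u (Re z) (Im z) - (ux (Re z) (Im z) * (Re w - Re z)
      + - vx (Re z) (Im z) * (Im w - Im z))) by (unfold g, l, Re, Im; simpl; ring).
  replace (Im (g w - g z - l * (w - z))%C) with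
    (v (Re w) (Im w) - v (Re z) (Im z) - (vx (Re z) (Im z) * (Re w - Re z)
      + ux (Re z) (Im z) * (Im w - Im z))) by (unfold g, l, Re, Im; simpl; ring).
  assert (B1 := H1 ltac:(lra) ltac:(lra)); assert (B2 := H2 ltac:(lra) ltac:(lra)).
  assert (K : eps / 5 * (Rabs (Re w - Re z) + Rabs (Im w - Im z)) <= eps / 5 * (2 * Cmod (w - z)%C)).
  { apply Rmult_le_compat_l; lra. }
  assert (0 < eps * Cmod (w - z)%C) by (apply Rmult_lt_0_compat; [apply cond_pos | exact Hp]).
  lra.
- now destruct (excluded_middle_informative (z = z)) as [_|N]; [|elim N].
- intros w; change (u (Re w) (Im w), v (Re w) (Im w)) with (g w).
  change (u (Re z) (Im z), v (Re z) (Im z)) with (g z).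
  destruct (excluded_middle_informative _) as [->|N]; [ring|].
  field; now apply Cminus_eq_contra.
Qed.

Lemma continuous_quat_pair (a b c d : R * R -> R) (p : R * R) :
  @continuous RxR R_UniformSpace a p -> @continuous RxR R_UniformSpace b p ->
  @continuous RxR R_UniformSpace c p -> @continuous RxR R_UniformSpace d p ->
  @continuous RxR quat_UniformSpace (fun q => (a q, b q, c q, d q)) p.
Proof.
intros Ha Hb Hc Hd.
apply filterlim_locally; intros eps.
assert (A := proj1 (filterlim_locally (U := R_UniformSpace) a (a p)) Ha eps).
assert (B := proj1 (filterlim_locally (U := R_UniformSpace) b (b p)) Hb eps).
assert (G := proj1 (filterlim_locally (U := R_UniformSpace) c (c p)) Hc eps).
assert (D := proj1 (filterlim_locally (U := R_UniformSpace) d (d p)) Hd eps).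
generalize (filter_and _ _ (filter_and _ _ A B) (filter_and _ _ G D)).
apply filter_imp; intros q [[h1 h2] [h3 h4]].
repeat split; assumption.
Qed.

Lemma slice_continuous (J : quat) (z : C) :
  @continuous RxR quat_UniformSpace (fun p => slice J (fst p) (snd p)) (Re z, Im z).
Proof.
destruct J as [[[a b] c] d].
apply (@continuous_ext RxR quat_UniformSpace
  (fun p => (fst p + snd p * a, snd p * b, snd p * c, snd p * d))).
{ intros [x y]; unfold slice; simpl; quat_unfold; repeat apply (f_equal2 pair); ring. }
assert (Hs : forall k, @continuous RxR R_UniformSpace (fun p => snd p * k) (Re z, Im z)).
{ intros k; apply (continuous_mult (K := R_AbsRing) (U := RxR) snd (fun _ => k)).
  - apply continuous_snd.
  - apply continuous_const. }
apply continuous_quat_pair; trivial.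
apply (continuous_plus (V := R_NormedModule) (U := RxR) fst); [apply continuous_fst | apply Hs].
Qed.

(** The adjoint of left multiplication by [J] is left multiplication by [- J]. Pairing fx = - J fy
    with [m] and with [J * m] therefore gives the Cauchy-Riemann equations of the two components of
    [lam J m]. *)
Lemma slice_hol (f : quat -> quat) (Omega : quat -> Prop) (J m : quat) :
  open Omega -> regular f Omega -> imag_unit J ->
  exists L', hol (fun z => Omega (qC J z)) (fun z => lam J m (f (qC J z))) L'.
Proof.
intros HO Hf HJ; destruct (Hf J HJ) as (fx & fy & H).
exists (fun z => lam J m (fx (Re z, Im z))); intros z Hz.
assert (Hloc : locally_2d (fun a b => Omega (slice J a b)) (Re z) (Im z)).
{ apply locally_2d_locally.
  apply (slice_continuous J z); apply HO; exact Hz. }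
assert (Hd : forall n, locally_2d (fun a b =>
   is_derive (fun t => qdot n (f (slice J t b))) a (qdot n (fx (a, b))) /\
   is_derive (fun t => qdot n (f (slice J a t))) b (qdot n (fy (a, b)))) (Re z) (Im z)).
{ intros n; revert Hloc; apply locally_2d_impl, locally_2d_forall.
  intros a b Hab; destruct (H a b Hab) as (D1 & D2 & _); split; now apply is_derive_qdot. }
destruct (H _ _ Hz) as (_ & _ & Cx & Cy & CR).
assert (Hcx : forall n, @continuous RxR R_UniformSpace (fun p => qdot n (fx p)) (Re z, Im z)).
{ intros n; exact (continuous_qdot n fx _ Cx). }
assert (Hcy : forall n, @continuous RxR R_UniformSpace (fun p => qdot n (fy p)) (Re z, Im z)).
{ intros n; exact (continuous_qdot n fy _ Cy). }
assert (H2 : forall (F : R * R -> R), @continuous RxR R_UniformSpace F (Re z, Im z) ->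
  continuity_2d_pt (fun a b => F (a, b)) (Re z) (Im z)).
{ intros F HF; apply continuity_2d_pt_filterlim.
  apply (filterlim_ext F); [intros [a b]; reflexivity | exact HF]. }
assert (CR' : forall n, qdot n (fx (Re z, Im z)) = - qdot n (J * fy (Re z, Im z))%H).
{ intros n; assert (E : qdot n (scal (/ 2) (fx (Re z, Im z) + J * fy (Re z, Im z))%H) = 0).
  { rewrite CR; clear; destruct n as [[[? ?] ?] ?]; unfold qdot, zero; simpl; unfold zero; simpl; ring. }
  rewrite qdot_scal_r, qdot_plus_r in E; lra. }
assert (CJ : forall n q : quat, qdot n (J * q)%H = - qdot (J * n)%H q).
{ intros n q; rewrite qdot_mult_r, qconj_imag_unit by assumption; clear; quat_auto. }
split.
- apply (cderiv_CR (fun a b => qdot m (f (slice J a b))) (fun a b => qdot (J * m)%H (f (slice J a b)))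
    (fun a b => qdot m (fx (a, b))) (fun a b => qdot m (fy (a, b)))
    (fun a b => qdot (J * m)%H (fx (a, b))) (fun a b => qdot (J * m)%H (fy (a, b)))).
  + apply Hd.
  + apply Hd.
  + apply (H2 (fun p => qdot m (fx p))), Hcx.
  + apply (H2 (fun p => qdot m (fy p))), Hcy.
  + apply (H2 (fun p => qdot (J * m)%H (fx p))), Hcx.
  + apply (H2 (fun p => qdot (J * m)%H (fy p))), Hcy.
  + rewrite CR', CJ; ring.
  + rewrite CR', CJ, imag_unit_sqr, qdot_opp_l by assumption; ring.
- assert (Hid : @continuous CU RxR (fun w => (Re w, Im w)) z).
  { apply filterlim_locally; intros eps.
    generalize (filter_and _ _
      (proj1 (filterlim_locally (U := R_UniformSpace) Re (Re z)) (continuous_Re z) eps)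
      (proj1 (filterlim_locally (U := R_UniformSpace) Im (Im z)) (continuous_Im z) eps)).
    apply filter_imp; intros w [h1 h2]; split; assumption. }
  apply (@continuous_Cpair CU (fun w => qdot m (fx (Re w, Im w)))
    (fun w => qdot (J * m)%H (fx (Re w, Im w)))).
  + apply (@continuous_comp CU RxR R_UniformSpace _ (fun p => qdot m (fx p)) z Hid), Hcx.
  + apply (@continuous_comp CU RxR R_UniformSpace _ (fun p => qdot (J * m)%H (fx p)) z Hid), Hcx.
Qed.

(** * Representation formula *)

(* The representation formula reads
   [F (x + J y) = rep_l I J * F (x + I y) + rep_r I J * F (x - I y)]. *)
Definition rep_l (I J : quat) : quat := scal (/ 2) (one - J * I)%H.
Definition rep_r (I J : quat) : quat := scal (/ 2) (one + J * I)%H.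

Ltac units :=
  repeat match goal with H : imag_unit ?J |- _ =>
    apply imag_unit_coords in H; destruct H as (? & ? & ? & -> & H) end.

Lemma qscal_mult_l (k : R) (p q : quat) : (scal k p * q)%H = scal k (p * q)%H.
Proof. quat_auto. Qed.

Lemma qscal_mult_r (k : R) (p q : quat) : (p * scal k q)%H = scal k (p * q)%H.
Proof. quat_auto. Qed.

(** Both sides equal (I + J) / 2. Left multiplication by [rep_l I J] thus carries the complex
    structure of [I] to that of [J], as [rep_r I J] does for [- I]. *)
Lemma rep_l_intertwine (I J : quat) :
  imag_unit I -> imag_unit J -> (J * rep_l I J)%H = (rep_l I J * I)%H.
Proof.
intros HI HJ; unfold rep_l; rewrite qscal_mult_l, qscal_mult_r; f_equal.
assert (E1 : (J * (one - J * I))%H = (J - J * (J * I))%H) by (clear; quat_auto).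
assert (E2 : ((one - J * I) * I)%H = (I - J * (I * I))%H) by (clear; quat_auto).
rewrite E1, E2, imag_unit_sqr by assumption.
rewrite HI; clear; quat_auto.
Qed.

Lemma rep_r_intertwine (I J : quat) :
  imag_unit I -> imag_unit J -> (J * rep_r I J)%H = (rep_r I J * - I)%H.
Proof.
intros HI HJ; unfold rep_r; rewrite qscal_mult_l, qscal_mult_r; f_equal.
assert (E1 : (J * (one + J * I))%H = (J + J * (J * I))%H) by (clear; quat_auto).
assert (E2 : ((one + J * I) * - I)%H = (- I - J * (I * I))%H) by (clear; quat_auto).
rewrite E1, E2, imag_unit_sqr by assumption.
rewrite HI; clear; quat_auto.
Qed.

Lemma rep_sum (I J : quat) : (rep_l I J + rep_r I J)%H = one.
Proof.
unfold rep_l, rep_r; quat_destruct; quat_unfold; repeat apply (f_equal2 pair); field.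
Qed.

Lemma qC_split (I : quat) (z : C) : qC I z = (quat_of_R (Re z) + scal (Im z) I)%H.
Proof. reflexivity. Qed.

Lemma qC_intertwine (I J A : quat) (z : C) :
  (J * A)%H = (A * I)%H -> (qC J z * A)%H = (A * qC I z)%H.
Proof.
intros H; rewrite !qC_split.
transitivity (quat_of_R (Re z) * A + scal (Im z) (J * A))%H; [clear; quat_auto|].
rewrite H; clear; quat_auto.
Qed.

Lemma qC_opp (I : quat) (z : C) : qC (- I)%H z = qC I (Cconj z).
Proof. destruct z as [x y]; unfold qC, slice, Cconj, Re, Im; simpl fst; simpl snd; quat_auto. Qed.

Lemma qC_rep_l (I J : quat) (z : C) : imag_unit I -> imag_unit J ->
  (qC J z * rep_l I J)%H = (rep_l I J * qC I z)%H.
Proof. intros HI HJ; apply qC_intertwine; now apply rep_l_intertwine. Qed.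

Lemma qC_rep_r (I J : quat) (z : C) : imag_unit I -> imag_unit J ->
  (qC J z * rep_r I J)%H = (rep_r I J * qC I (Cconj z))%H.
Proof.
intros HI HJ; rewrite <- qC_opp; apply qC_intertwine; now apply rep_r_intertwine.
Qed.

Lemma qconj_mult (p q : quat) : qconj (p * q)%H = (qconj q * qconj p)%H.
Proof. quat_auto. Qed.

(** The conjugate of J A = A I moves [A] into the test vector. Each term of the representation
    formula thereby becomes a functional of [f] on its own line, to which [slice_hol] applies. *)
Lemma lam_intertwine (I J A m q : quat) :
  imag_unit I -> imag_unit J -> (J * A)%H = (A * I)%H ->
  lam J m (A * q)%H = lam I (qconj A * m)%H q.
Proof.
intros HI HJ H; unfold lam; rewrite !qdot_mult_r; f_equal.
f_equal; rewrite !mult_assoc; f_equal.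
assert (E := f_equal qconj H); rewrite !qconj_mult, (qconj_imag_unit I HI), (qconj_imag_unit J HJ) in E.
transitivity (- (qconj A * - J))%H; [clear; quat_auto|].
rewrite E; clear; quat_auto.
Qed.

Lemma lam_minus (I m p q : quat) : lam I m (p - q)%H = (lam I m p - lam I m q)%C.
Proof. unfold lam; apply C_ext; unfold Re, Im; simpl; quat_auto. Qed.

Lemma representation (f : quat -> quat) (Omega : quat -> Prop) (I J : quat)
    (x0 y0 R1 R2 : R) (z : C) :
  open Omega -> regular f Omega -> imag_unit I -> imag_unit J ->
  0 <= y0 -> 0 <= R1 ->
  (forall K w, imag_unit K -> lens x0 y0 R1 R2 w -> Omega (qC K w)) ->
  lens x0 y0 R1 R2 z -> 0 <= Im z ->
  f (qC J z) = (rep_l I J * f (qC I z) + rep_r I J * f (qC I (Cconj z)))%H.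
Proof.
intros HO Hf HI HJ Hy0 HR1 HOm Hz Hz0.
apply qdot_ext; intros m.
assert (HIo := imag_unit_opp I HI).
set (A := rep_l I J); set (B := rep_r I J).
destruct (slice_hol f Omega J m HO Hf HJ) as [L1 H1].
destruct (slice_hol f Omega I (qconj A * m)%H HO Hf HI) as [L2 H2].
destruct (slice_hol f Omega (- I)%H (qconj B * m)%H HO Hf HIo) as [L3 H3].
(* The value at x - I y is read as the value at x + (- I) y, so that the third term too is
   holomorphic in [w], not antiholomorphic. *)
set (h := fun w => (lam J m (f (qC J w)) - lam I (qconj A * m)%H (f (qC I w))
                   - lam (- I)%H (qconj B * m)%H (f (qC (- I)%H w)))%C).
assert (Hh : exists h', hol (lens x0 y0 R1 R2) h h').
{ eexists; apply hol_minus; [apply hol_minus|].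
  - apply hol_sub with (2 := H1); intros w Hw; now apply HOm.
  - apply hol_sub with (2 := H2); intros w Hw; now apply HOm.
  - apply hol_sub with (2 := H3); intros w Hw; now apply HOm. }
destruct Hh as [h' Hh].
assert (Eh : forall w, h w = lam J m (f (qC J w) - A * f (qC I w) - B * f (qC I (Cconj w)))%H).
{ intros w; unfold h; rewrite !lam_minus.
  rewrite (lam_intertwine I J A), (lam_intertwine (- I)%H J B); trivial.
  - now rewrite qC_opp.
  - now apply rep_r_intertwine.
  - now apply rep_l_intertwine. }
assert (Hv : h z = RtoC 0).
{ apply (lens_vanish h h' x0 y0 R1 R2); trivial.
  intros w Hw Hw0; rewrite Eh.
  assert (E : forall K, qC K w = quat_of_R (Re w)).
  { intros K; rewrite qC_split, Hw0; clear; quat_auto. }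
  assert (Ec : forall K, qC K (Cconj w) = quat_of_R (Re w)).
  { intros K; rewrite <- qC_opp; apply E. }
  rewrite !E, Ec; set (q := f (quat_of_R (Re w))).
  replace (q - A * q - B * q)%H with (q - (A + B) * q)%H by (clearbody q A B; clear; quat_auto).
  unfold A, B; rewrite rep_sum.
  unfold lam; apply C_ext; unfold Re, Im; simpl; clearbody q; clear; quat_auto. }
rewrite Eh in Hv; apply (f_equal Re) in Hv; unfold Re, lam in Hv; simpl in Hv.
revert Hv; generalize (f (qC J z)) (A * f (qC I z))%H (B * f (qC I (Cconj z)))%H.
intros u v w Hv; rewrite qdot_plus_r.
assert (E : forall a b c : quat, qdot m (a - b - c)%H = qdot m a - qdot m b - qdot m c)
  by (clear; quat_auto).
rewrite E in Hv; lra.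
Qed.

(** * Quaternion series through their real functionals *)

Definition basis_coefs (F : quat -> R) : quat :=
  (F (1, 0, 0, 0), F (0, 1, 0, 0), F (0, 0, 1, 0), F (0, 0, 0, 1)).

Lemma basis_coefs_qdot (q : quat) : basis_coefs (fun m => qdot m q) = q.
Proof.
destruct q as [[[a b] c] d]; unfold basis_coefs, qdot; repeat apply (f_equal2 pair); ring.
Qed.

Lemma qdot_sum_n (m : quat) (u : nat -> quat) (n : nat) :
  sum_n (fun k => qdot m (u k)) n = qdot m (sum_n u n).
Proof.
induction n as [|n IH]; [now rewrite !sum_O|].
rewrite !sum_Sn, IH, qdot_plus_r; reflexivity.
Qed.

Lemma quat_series_qdot (m : quat) (u : nat -> quat) (s : quat) :
  is_series u s -> is_series (fun n => qdot m (u n)) (qdot m s).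
Proof.
intros H; apply (filterlim_ext (fun n => qdot m (sum_n u n))).
- intros n; now rewrite qdot_sum_n.
- apply (filterlim_comp _ _ _ (sum_n u) (qdot m) _ _ _ H).
  exact (continuous_qdot m (fun q => q) s (continuous_id s)).
Qed.

Lemma quat_series_basis (u : nat -> quat) (F : quat -> R) :
  (forall m, is_series (fun n => qdot m (u n)) (F m)) -> is_series u (basis_coefs F).
Proof.
intros H.
assert (H' : forall m, filterlim (fun n => qdot m (sum_n u n)) eventually (locally (F m))).
{ intros m; apply filterlim_ext with (2 := H m); intros n; apply qdot_sum_n. }
apply (filterlim_locally (U := quat_UniformSpace)); intros eps.
assert (A1 := proj1 (filterlim_locally (U := R_UniformSpace) _ _) (H' (1, 0, 0, 0)) eps).
assert (A2 := proj1 (filterlim_locally (U := R_UniformSpace) _ _) (H' (0, 1, 0, 0)) eps).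
assert (A3 := proj1 (filterlim_locally (U := R_UniformSpace) _ _) (H' (0, 0, 1, 0)) eps).
assert (A4 := proj1 (filterlim_locally (U := R_UniformSpace) _ _) (H' (0, 0, 0, 1)) eps).
generalize (filter_and _ _ (filter_and _ _ A1 A2) (filter_and _ _ A3 A4)).
apply filter_imp; intros n [[h1 h2] [h3 h4]].
change (@sum_n quat_NormedModule u n) with (@sum_n quat_AbelianMonoid u n).
destruct (@sum_n quat_AbelianMonoid u n) as [[[a b] c] d].
revert h1 h2 h3 h4; unfold qdot.
rewrite !Rmult_1_l, !Rmult_0_l, !Rplus_0_l, !Rplus_0_r.
intros h1 h2 h3 h4; repeat split; assumption.
Qed.

Lemma quat_series_mult_plus (A B : quat) (u v : nat -> quat) (s t : quat) :
  is_series u s -> is_series v t ->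
  is_series (fun n => (A * u n + B * v n)%H) (A * s + B * t)%H.
Proof.
intros Hu Hv; rewrite <- (basis_coefs_qdot (A * s + B * t)%H).
apply quat_series_basis; intros m.
rewrite qdot_plus_r, !qdot_mult_r.
apply (is_series_ext (fun n => plus (qdot (qconj A * m)%H (u n)) (qdot (qconj B * m)%H (v n)))).
{ intros n; now rewrite qdot_plus_r, !qdot_mult_r. }
apply (is_series_plus (V := R_NormedModule)); now apply quat_series_qdot.
Qed.

Lemma bilateral_mult_plus (A B : quat) (u v : Z -> quat) (s t : quat) :
  is_bilateral_series u s -> is_bilateral_series v t ->
  is_bilateral_series (fun n => (A * u n + B * v n)%H) (A * s + B * t)%H.
Proof.
intros (s1 & s2 & U1 & U2 & ->) (t1 & t2 & V1 & V2 & ->).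
exists (A * s1 + B * t1)%H, (A * s2 + B * t2)%H; split; [|split].
- exact (quat_series_mult_plus A B _ _ _ _ U1 V1).
- exact (quat_series_mult_plus A B _ _ _ _ U2 V2).
- clear; quat_auto.
Qed.

(** * Regular powers: values on the line of p and representation formula *)

Lemma poly_lin_pow_S (p : quat) (n k : nat) :
  poly_lin_pow p (S n) k =
  ((match k with O => zero | S j => poly_lin_pow p n j end) - poly_lin_pow p n k * p)%H.
Proof.
simpl poly_lin_pow; unfold poly_star.
assert (E : forall q : quat, (q * - p)%H = (- (q * p))%H) by (clear; quat_auto).
destruct k as [|k].
- rewrite sum_O; simpl; rewrite E; generalize (poly_lin_pow p n 0 * p)%H; clear.
  intros q; symmetry; apply plus_zero_l.
- rewrite sum_Sn, Nat.sub_diag; change (poly_lin p 0) with (- p)%H; rewrite E.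
  (* The term l = k + 1, already split off, carries [- p]; among the others only l = k meets a
     nonzero coefficient of q - p. *)
  rewrite (sum_n_ext_loc _ (fun l => if Nat.eq_dec l k then poly_lin_pow p n k else zero)).
  + assert (S1 : forall N, sum_n (fun l => if Nat.eq_dec l k then poly_lin_pow p n k else zero) N
        = if le_dec k N then poly_lin_pow p n k else zero).
    { intros N; induction N as [|N IH].
      - rewrite sum_O; destruct (Nat.eq_dec 0 k), (le_dec k 0); try lia; reflexivity.
      - rewrite sum_Sn, IH.
        destruct (Nat.eq_dec (S N) k), (le_dec k N), (le_dec k (S N)); try lia;
          rewrite ?plus_zero_l, ?plus_zero_r; reflexivity. }
    rewrite S1; destruct (le_dec k k); [reflexivity | lia].
  + intros l Hl; destruct (Nat.eq_dec l k) as [->|N].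
    * replace (S k - k)%nat with 1%nat by lia; apply (@mult_one_r quat_Ring).
    * replace (S k - l)%nat with (S (S (k - l - 1)))%nat by lia.
      apply (@mult_zero_r quat_Ring).
Qed.

Lemma reg_pow_0 (p q : quat) : reg_pow p 0 q = one.
Proof. unfold reg_pow; rewrite sum_O; simpl; apply (@mult_one_r quat_Ring). Qed.

Lemma reg_pow_S (p q : quat) (n : nat) :
  reg_pow p (S n) q = (q * reg_pow p n q - reg_pow p n q * p)%H.
Proof.
unfold reg_pow.
(* The truncation [N] is freed from the exponent for the induction. At N = n the last sum has one
   term beyond the degree, and [poly_lin_pow_deg] removes it. *)
assert (T : forall N, sum_n (fun k => (q ^ k * poly_lin_pow p (S n) k)%H) (S N)
  = (q * sum_n (fun k => q ^ k * poly_lin_pow p n k)%H N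
     - sum_n (fun k => q ^ k * poly_lin_pow p n k)%H (S N) * p)%H).
{ assert (D : forall a b c : quat, (a * (b - c * p))%H = (a * b - a * c * p)%H) by (clear; quat_auto).
  assert (C0 : forall a b c d : quat, (a - b * p + (c - d * p))%H = (a + c - (b + d) * p)%H)
    by (clear; quat_auto).
  intros N; induction N as [|N IH].
  - rewrite !sum_Sn, !sum_O, !poly_lin_pow_S, !D, C0.
    f_equal.
    generalize (poly_lin_pow p n 0); clear; intros w; simpl; quat_destruct.
    quat_unfold; repeat apply (f_equal2 pair); ring.
  - rewrite sum_Sn, IH, poly_lin_pow_S, D, C0.
    rewrite (sum_Sn _ (S N)); f_equal.
    rewrite sum_Sn, mult_distr_l; f_equal.
    change (q ^ S (S N))%H with (q * q ^ S N)%H; now rewrite mult_assoc. }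
rewrite T, (sum_Sn _ n), (poly_lin_pow_deg p n (S n)) by lia.
rewrite (@mult_zero_r quat_Ring), plus_zero_r; reflexivity.
Qed.

Lemma qC_conj (I : quat) (z : C) : imag_unit I -> qconj (qC I z) = qC I (Cconj z).
Proof.
intros HI; destruct z as [x y]; units; unfold qC, slice, Cconj, Re, Im; simpl fst; simpl snd; quat_auto.
Qed.

Lemma reg_pow_qC (I : quat) (p z : C) (n : nat) : imag_unit I ->
  reg_pow (qC I p) n (qC I z) = qC I ((z - p) ^ n)%C.
Proof.
intros HI; induction n as [|n IH].
- rewrite reg_pow_0, qC_pow by assumption; reflexivity.
- rewrite reg_pow_S, IH, <- !qC_mult, <- qC_minus by assumption.
  f_equal; rewrite Cpow_S; ring.
Qed.

Lemma rep_mult_l (I J X Y : quat) (c : C) : imag_unit I -> imag_unit J ->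
  (qC J c * (rep_l I J * X + rep_r I J * Y))%H
  = (rep_l I J * (qC I c * X) + rep_r I J * (qC I (Cconj c) * Y))%H.
Proof.
intros HI HJ.
assert (D : forall a b c d e : quat, (a * (b * c + d * e))%H = (a * b * c + a * d * e)%H)
  by (clear; quat_auto).
rewrite D, qC_rep_l, qC_rep_r, <- !mult_assoc by assumption; reflexivity.
Qed.

(** The recursion X -> q X - X P preserves the formula: [q] passes the left factors by intertwining,
    and [P] acts on the other side. *)
Lemma reg_pow_rep (I J P : quat) (z : C) (n : nat) : imag_unit I -> imag_unit J ->
  reg_pow P n (qC J z) =
  (rep_l I J * reg_pow P n (qC I z) + rep_r I J * reg_pow P n (qC I (Cconj z)))%H.
Proof.
intros HI HJ; induction n as [|n IH].
- assert (D : forall a b : quat, (a + b)%H = (a * one + b * one)%H) by (clear; quat_auto).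
  rewrite !reg_pow_0, <- D; symmetry; apply rep_sum.
- rewrite !reg_pow_S, IH, rep_mult_l by assumption.
  assert (D : forall a b c d x y q : quat,
    (a * (c * x) + b * (d * y) - (a * x + b * y) * q)%H
    = (a * (c * x - x * q) + b * (d * y - y * q))%H) by (clear; quat_auto).
  apply D.
Qed.

(** The polynomial vanishing on the sphere of p, read in a complex coordinate. Its coefficients are
    real, so it has the same expression on every line and commutes with conjugation. *)
Definition sphere_poly (p z : C) : C := ((z - RtoC (Re p)) ^ 2 + RtoC (Im p ^ 2))%C.

Lemma sphere_poly_factor (p z : C) : sphere_poly p z = ((z - p) * (z - Cconj p))%C.
Proof. unfold sphere_poly; apply C_ext; unfold Re, Im; simpl; ring. Qed.

Lemma sphere_poly_conj (p z : C) : Cconj (sphere_poly p z) = sphere_poly p (Cconj z).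
Proof. unfold sphere_poly; apply C_ext; unfold Re, Im; simpl; ring. Qed.

Lemma qre_qC (I : quat) (z : C) : imag_unit I -> qre (qC I z) = Re z.
Proof. intros HI; units; unfold qC, slice; quat_unfold; ring. Qed.

Lemma qimnorm_qC (I : quat) (z : C) : imag_unit I -> qimnorm (qC I z) = Rabs (Im z).
Proof.
intros HI; units; unfold qC, slice; quat_unfold.
match goal with |- sqrt ?s = _ => replace s with (Im z ^ 2) end.
- rewrite <- pow2_abs; apply sqrt_pow2, Rabs_pos.
- match goal with H : ?s = 1 |- _ => transitivity (Im z ^ 2 * s); [rewrite H|]; ring end.
Qed.

Lemma qC_RtoC (I : quat) (x : R) : qC I (RtoC x) = quat_of_R x.
Proof. unfold qC, slice, RtoC, Re, Im; simpl fst; simpl snd; quat_auto. Qed.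

Lemma qC_plus (I : quat) (z w : C) : qC I (z + w)%C = (qC I z + qC I w)%H.
Proof.
destruct z as [x y], w as [u v]; unfold qC, slice, Re, Im; simpl fst; simpl snd; quat_auto.
Qed.

Lemma reg_pow_neg_qC (I J : quat) (p z : C) (n : nat) : imag_unit I -> imag_unit J ->
  qC J z <> qconj (qC I p) ->
  reg_pow_neg (qC I p) n (qC J z) =
  (qC J ((/ sphere_poly p z) ^ n)%C * reg_pow (qC I (Cconj p)) n (qC J z))%H.
Proof.
intros HI HJ Hn; unfold reg_pow_neg.
destruct (excluded_middle_informative _) as [E|_]; [contradiction|].
rewrite qre_qC, qimnorm_qC, pow2_abs, qC_conj by assumption.
unfold sphere_poly; rewrite qC_pow, qC_inv, qC_plus, qC_pow, qC_minus, !qC_RtoC by assumption.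
reflexivity.
Qed.

Lemma qC_eq (I J : quat) (z w : C) : imag_unit I -> imag_unit J ->
  qC J z = qC I w -> z = w \/ z = Cconj w.
Proof.
intros HI HJ H.
assert (H1 := f_equal qre H); assert (H2 := f_equal qimnorm H).
rewrite !qre_qC in H1 by assumption; rewrite !qimnorm_qC in H2 by assumption.
destruct z as [x y], w as [u v]; unfold Re, Im, Cconj in *; simpl in *; subst u.
unfold Rabs in H2; destruct (Rcase_abs y), (Rcase_abs v);
  (left; f_equal; lra) || (right; f_equal; lra).
Qed.

Definition cpowZ (w : C) (n : Z) : C :=
  match n with
  | Z0 => RtoC 1
  | Zpos m => (w ^ Pos.to_nat m)%C
  | Zneg m => ((/ w) ^ Pos.to_nat m)%C
  end.

Lemma reg_powZ_qC (I : quat) (p z : C) (n : Z) : imag_unit I -> z <> p ->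
  reg_powZ (qC I p) n (qC I z) = qC I (cpowZ (z - p)%C n).
Proof.
intros HI Hz; destruct n as [|m|m]; simpl reg_powZ; unfold cpowZ.
- now rewrite reg_pow_qC.
- now apply reg_pow_qC.
- destruct (excluded_middle_informative (qC I z = qconj (qC I p))) as [E|E].
  (* Here [sphere_poly] vanishes, and the value prescribed at the conjugate of p is exactly the
     power of z - p. *)
  + unfold reg_pow_neg; destruct (excluded_middle_informative _) as [_|N]; [|contradiction].
    rewrite <- E, <- qC_minus, <- qC_inv, <- qC_pow by assumption; reflexivity.
  + rewrite reg_pow_neg_qC, reg_pow_qC, <- qC_mult by assumption; f_equal.
    rewrite sphere_poly_factor, <- Cpow_mult_l; f_equal.
    assert (z <> Cconj p) by (intros ->; apply E; now rewrite qC_conj).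
    field; split; now apply Cminus_eq_contra.
Qed.

Lemma reg_powZ_rep (I J : quat) (p z : C) (n : Z) : imag_unit I -> imag_unit J ->
  z <> p -> z <> Cconj p ->
  reg_powZ (qC I p) n (qC J z) =
  (rep_l I J * reg_powZ (qC I p) n (qC I z)
   + rep_r I J * reg_powZ (qC I p) n (qC I (Cconj z)))%H.
Proof.
intros HI HJ Hz Hz'.
assert (Hc : forall w, Cconj (Cconj w) = w).
{ intros [x y]; unfold Cconj; simpl; f_equal; ring. }
destruct n as [|m|m]; simpl reg_powZ; try now apply reg_pow_rep.
assert (N : forall K w, imag_unit K -> (w = z \/ w = Cconj z) -> qC K w <> qconj (qC I p)).
{ intros K w HK Hw E; rewrite qC_conj in E by assumption.
  apply qC_eq in E; trivial; rewrite Hc in E.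
  destruct Hw as [-> | ->], E as [E|E]; try contradiction; apply (f_equal Cconj) in E;
    rewrite ?Hc in E; contradiction. }
rewrite !reg_pow_neg_qC by (try assumption; apply N; auto).
rewrite (reg_pow_rep I J), rep_mult_l by assumption.
(* Passing [rep_r] has conjugated the scalar factor; what remains is that this conjugate is the
   factor at the conjugate point. *)
rewrite Cpow_conj; do 5 f_equal.
rewrite <- sphere_poly_conj; apply Cinv_conj.
rewrite sphere_poly_factor; apply Cmult_neq_0; now apply Cminus_eq_contra.
Qed.

(** The quaternion-valued mean of w^(-n) f(p + w) over the circle of radius r in the line of [I],
    assembled from its four real coordinates. *)
Definition laurent_coef (f : quat -> quat) (I : quat) (p : C) (r : R) (n : Z) : quat :=
  basis_coefs (fun m => re_mean (fun w => (cpowZ w (- n) * lam I m (f (qC I (p + w)%C)))%C) r).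

Lemma ccont_cpowZ (w : C) (n : Z) : w <> RtoC 0 -> ccont (fun w => cpowZ w n) w.
Proof.
intros Hw; destruct n as [|m|m]; unfold cpowZ.
- apply ccont_const.
- apply (@continuous_Cpow CU), ccont_id.
- apply (@continuous_Cpow CU); now apply ccont_inv.
Qed.

Lemma qdot_basis_coefs (m : quat) (F : quat -> R) :
  qdot m (basis_coefs F) =
  let '(a, b, c, d) := m in
  a * F (1, 0, 0, 0) + b * F (0, 1, 0, 0) + c * F (0, 0, 1, 0) + d * F (0, 0, 0, 1).
Proof. destruct m as [[[a b] c] d]; reflexivity. Qed.

Lemma lam_basis (I q : quat) (a b c d : R) :
  lam I (a, b, c, d) q =
  (RtoC a * lam I (1, 0, 0, 0)%R q + RtoC b * lam I (0, 1, 0, 0)%R q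
   + (RtoC c * lam I (0, 0, 1, 0)%R q + RtoC d * lam I (0, 0, 0, 1)%R q))%C.
Proof.
assert (E : (I * ((a, b, c, d) : quat))%H =
  (scal a (I * ((1, 0, 0, 0) : quat)) + scal b (I * ((0, 1, 0, 0) : quat))
   + (scal c (I * ((0, 0, 1, 0) : quat)) + scal d (I * ((0, 0, 0, 1) : quat))))%H)
  by quat_auto.
assert (S : forall k l m n : quat, qdot (scal a k + scal b l + (scal c m + scal d n))%H q
  = a * qdot k q + b * qdot l q + (c * qdot m q + d * qdot n q)) by (clear; quat_auto).
unfold lam; rewrite E, S; clear E S.
generalize (qdot (I * ((1, 0, 0, 0) : quat))%H q) (qdot (I * ((0, 1, 0, 0) : quat))%H q)
  (qdot (I * ((0, 0, 1, 0) : quat))%H q) (qdot (I * ((0, 0, 0, 1) : quat))%H q).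
intros e1 e2 e3 e4; quat_destruct; unfold qdot.
apply C_ext; unfold Re, Im; simpl; ring.
Qed.

Lemma qdot_laurent_coef (f : quat -> quat) (I : quat) (p : C) (r : R) (n : Z) (m : quat) :
  0 < r -> (forall m w, Cmod w = r -> ccont (fun w => lam I m (f (qC I (p + w)%C))) w) ->
  qdot m (laurent_coef f I p r n)
  = re_mean (fun w => (cpowZ w (- n) * lam I m (f (qC I (p + w)%C)))%C) r.
Proof.
intros Hr Hf; set (g := fun m w => (cpowZ w (- n) * lam I m (f (qC I (p + w)%C)))%C).
assert (Hg : forall m w, Cmod w = r -> ccont (g m) w).
{ intros k w Hw; apply ccont_mult; [|now apply Hf].
  apply ccont_cpowZ, Cmod_gt_0; lra. }
unfold laurent_coef; rewrite qdot_basis_coefs; destruct m as [[[a b] c] d].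
fold (g (1, 0, 0, 0)) (g (0, 1, 0, 0)) (g (0, 0, 1, 0)) (g (0, 0, 0, 1)) (g (a, b, c, d)).
rewrite (re_mean_ext (g (a, b, c, d)) (fun w =>
   (1 * (a * g (1, 0, 0, 0) w + b * g (0, 1, 0, 0) w)
    + 1 * (c * g (0, 0, 1, 0) w + d * g (0, 0, 0, 1) w))%C)); [|lra|].
- assert (Hl : forall k l x y w, Cmod w = r -> ccont (fun w => (RtoC x * g k w + RtoC y * g l w)%C) w).
  { intros k l x y w Hw; apply ccont_plus; apply ccont_mult; auto; apply ccont_const. }
  rewrite (re_mean_lin (fun w => (a * g (1, 0, 0, 0)%R w + b * g (0, 1, 0, 0)%R w)%C)
    (fun w => (c * g (0, 0, 1, 0)%R w + d * g (0, 0, 0, 1)%R w)%C)); auto; [|lra].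
  rewrite !re_mean_lin; auto; try lra; ring.
- intros w _; unfold g.
  match goal with |- (?A * ?B)%C = _ => set (cw := A); set (q := f (qC I (p + w)%C)) end.
  assert (E : lam I (a, b, c, d) q = (RtoC a * lam I (1, 0, 0, 0)%R q + RtoC b * lam I (0, 1, 0, 0)%R q
     + (RtoC c * lam I (0, 0, 1, 0)%R q + RtoC d * lam I (0, 0, 0, 1)%R q))%C).
  { apply lam_basis. }
  rewrite E; ring.
Qed.

Lemma lam_laurent_coef (f : quat -> quat) (I : quat) (p : C) (r : R) (n : Z) (m : quat) :
  imag_unit I ->
  0 < r -> (forall m w, Cmod w = r -> ccont (fun w => lam I m (f (qC I (p + w)%C))) w) ->
  lam I m (laurent_coef f I p r n)
  = mean (fun w => (cpowZ w (- n) * lam I m (f (qC I (p + w)%C)))%C) r.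
Proof.
intros HI Hr Hf; unfold lam at 1; rewrite !qdot_laurent_coef by assumption; unfold mean; f_equal.
apply re_mean_ext; [lra|]; intros w _.
(* This matches the imaginary coordinate of [lam] with the [- Ci] in the definition of [mean]. *)
assert (E : forall q, lam I (I * m)%H q = (- Ci * lam I m q)%C).
{ intros q; unfold lam; rewrite imag_unit_sqr, qdot_opp_l by assumption.
  apply C_ext; unfold Re, Im; simpl; ring. }
rewrite E; ring.
Qed.

(** * Laurent expansion in a shell *)

Lemma Cseries_Re (u : nat -> C) (s : C) :
  is_Cseries u s -> is_series (fun n => Re (u n)) (Re s).
Proof.
intros H; apply (filterlim_ext (fun n => Re (@sum_n (AbsRing_NormedModule C_AbsRing) u n))).
- intros n; induction n as [|n IH]; [now rewrite !sum_O|].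
  rewrite !sum_Sn, <- IH; reflexivity.
- exact (filterlim_comp _ _ _ _ Re _ _ _ H (continuous_Re s)).
Qed.

Lemma cpowZ_of_nat (w : C) (k : nat) : cpowZ w (Z.of_nat k) = (w ^ k)%C.
Proof.
destruct k as [|k]; [reflexivity|].
unfold cpowZ; simpl Z.of_nat; cbv iota; now rewrite SuccNat2Pos.id_succ.
Qed.

Lemma cpowZ_opp_of_nat (w : C) (k : nat) : cpowZ w (- Z.of_nat k) = ((/ w) ^ k)%C.
Proof.
destruct k as [|k]; [reflexivity|].
unfold cpowZ; simpl; now rewrite SuccNat2Pos.id_succ.
Qed.

Lemma laurent_qC (f : quat -> quat) (Omega : quat -> Prop) (I : quat) (p z : C) (R1 R2 r : R) :
  open Omega -> regular f Omega -> imag_unit I -> 0 <= R1 -> R1 < r < R2 ->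
  (forall w, R1 < Cmod (w - p)%C < R2 -> Omega (qC I w)) ->
  R1 < Cmod (z - p)%C < R2 ->
  is_bilateral_series (fun n => (reg_powZ (qC I p) n (qC I z) * laurent_coef f I p r n)%H)
    (f (qC I z)).
Proof.
intros HO Hf HI HR1 Hr HOm Hz.
set (g := fun m w => lam I m (f (qC I (p + w)%C))).
assert (Hg : forall m, exists g', hol (fun w => R1 < Cmod w < R2) (g m) g').
{ intros m; destruct (slice_hol f Omega I m HO Hf HI) as [L HL].
  eexists; apply hol_sub with (2 := hol_shift _ _ _ p HL); intros w Hw.
  apply HOm; replace (p + w - p)%C with w by ring; exact Hw. }
assert (Hgc : forall m w, Cmod w = r -> ccont (fun w => lam I m (f (qC I (p + w)%C))) w).
{ intros m w Hw; destruct (Hg m) as [g' Hg'].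
  apply (hol_continuous _ _ _ _ Hg'); lra. }
assert (Hzp : z <> p).
{ intros ->; replace (p - p)%C with (RtoC 0) in Hz by ring; rewrite Cmod_0 in Hz; lra. }
set (u := fun n => (reg_powZ (qC I p) n (qC I z) * laurent_coef f I p r n)%H).
assert (Hu : forall m n, qdot m (u n) =
  Re (cpowZ (z - p)%C n * mean (fun w => (cpowZ w (- n) * g m w)%C) r)%C).
{ intros m n; unfold u; rewrite reg_powZ_qC by assumption.
  change (qdot m ?q) with (Re (lam I m q)).
  rewrite lam_mult, lam_laurent_coef by (trivial; lra); reflexivity. }
assert (HS : forall m, exists x1 x2 : R,
  is_series (fun k : nat => qdot m (u (Z.of_nat k))) x1 /\
  is_series (fun k : nat => qdot m (u (- Z.of_nat (S k))%Z)) x2 /\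
  qdot m (f (qC I z)) = x1 + x2).
{ intros m; destruct (Hg m) as [g' Hg'].
  destruct (laurent (g m) g' R1 R2 r (z - p)%C HR1 Hg' Hr Hz) as (s1 & s2 & S1 & S2 & E).
  exists (Re s1), (Re s2); split; [|split].
  - apply is_series_ext with (2 := Cseries_Re _ _ S1); intros k.
    rewrite Hu, cpowZ_of_nat; unfold coefp; f_equal; f_equal.
    apply mean_ext; [lra|]; intros w _; now rewrite cpowZ_opp_of_nat.
  - apply is_series_ext with (2 := Cseries_Re _ _ S2); intros k.
    rewrite Hu, cpowZ_opp_of_nat; unfold coefm; f_equal; f_equal.
    apply mean_ext; [lra|]; intros w _; now rewrite Z.opp_involutive, cpowZ_of_nat.
  - unfold g in E; replace (p + (z - p))%C with z in E by ring.
    apply (f_equal Re) in E; exact E. }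
(* [Series] turns the sums into functions of [m], which [basis_coefs] can assemble. Uniqueness of
   sums then shows that pairing the result with any [m] gives back [F1 m], and likewise for [F2]. *)
set (F1 := fun m => Series (fun k : nat => qdot m (u (Z.of_nat k)))).
set (F2 := fun m => Series (fun k : nat => qdot m (u (- Z.of_nat (S k))%Z))).
assert (HF : forall m, is_series (fun k : nat => qdot m (u (Z.of_nat k))) (F1 m) /\
  is_series (fun k : nat => qdot m (u (- Z.of_nat (S k))%Z)) (F2 m) /\
  qdot m (f (qC I z)) = F1 m + F2 m).
{ intros m; destruct (HS m) as (x1 & x2 & S1 & S2 & E).
  unfold F1, F2; rewrite (is_series_unique _ _ S1), (is_series_unique _ _ S2); auto. }
assert (Q1 := quat_series_basis (fun k => u (Z.of_nat k)) F1 (fun m => proj1 (HF m))).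
assert (Q2 := quat_series_basis (fun k => u (- Z.of_nat (S k))%Z) F2 (fun m => proj1 (proj2 (HF m)))).
exists (basis_coefs F1), (basis_coefs F2); split; [exact Q1|split; [exact Q2|]].
apply qdot_ext; intros m; rewrite qdot_plus_r.
destruct (HF m) as (S1 & S2 & ->).
rewrite <- (is_series_unique _ _ (quat_series_qdot m _ _ Q1)).
rewrite <- (is_series_unique _ _ (quat_series_qdot m _ _ Q2)).
reflexivity.
Qed.

Lemma quat_polar (q : quat) :
  exists (J : quat) (z : C), imag_unit J /\ 0 <= Im z /\ q = qC J z.
Proof.
destruct q as [[[a b] c] d].
set (s := b ^ 2 + c ^ 2 + d ^ 2).
assert (Hs : 0 <= s) by (unfold s; nra).
destruct (Req_dec s 0) as [E|N].
- exists (0, 1, 0, 0), (a, 0); split; [|split].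
  + apply imag_unit_coords; exists 1, 0, 0; split; [reflexivity | ring].
  + unfold Im; simpl; lra.
  + assert (b = 0) by (unfold s in E; nra).
    assert (c = 0) by (unfold s in E; nra).
    assert (d = 0) by (unfold s in E; nra); subst.
    unfold qC, slice, Re, Im; simpl fst; simpl snd; quat_unfold.
    repeat apply (f_equal2 pair); ring.
- assert (Hp : 0 < sqrt s) by (apply sqrt_lt_R0; lra).
  assert (H2 : sqrt s ^ 2 = s) by now apply pow2_sqrt.
  exists (0, b / sqrt s, c / sqrt s, d / sqrt s), (a, sqrt s); split; [|split].
  + apply imag_unit_coords; exists (b / sqrt s), (c / sqrt s), (d / sqrt s).
    split; [reflexivity|].
    transitivity ((b ^ 2 + c ^ 2 + d ^ 2) / sqrt s ^ 2); [field; lra|].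
    rewrite H2; fold s; field; lra.
  + unfold Im; simpl; lra.
  + unfold qC, slice, Re, Im; simpl fst; simpl snd; quat_unfold.
    repeat apply (f_equal2 pair); field; lra.
Qed.

Lemma qnorm_qC (I : quat) (z : C) : imag_unit I -> qnorm (qC I z) = Cmod z.
Proof.
intros HI; units; unfold qC, slice, Cmod; quat_unfold; f_equal.
match goal with H : ?s = 1 |- _ => transitivity (Re z ^ 2 + Im z ^ 2 * s) end.
- ring.
- match goal with H : _ = 1 |- _ => rewrite H end; unfold Re, Im; simpl; ring.
Qed.

Lemma Cmod_conj_minus (z w : C) : Cmod (Cconj z - w)%C = Cmod (z - Cconj w)%C.
Proof.
rewrite <- Cmod_conj; f_equal; apply C_ext; unfold Re, Im; simpl; ring.
Qed.

(** On the common line each of the two points has its coordinate or the conjugate one; conjugating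
    both changes no distance, which leaves two possibilities. *)
Lemma same_line_qnorm (I J : quat) (p z : C) : imag_unit I -> imag_unit J ->
  same_line (qC I p) (qC J z) ->
  qnorm (qC J z - qC I p)%H = Cmod (z - p)%C \/
  qnorm (qC J z - qC I p)%H = Cmod (z - Cconj p)%C.
Proof.
intros HI HJ (L & HL & (a & b & Ep) & (c & d & Eq)).
assert (Ep' : qC I p = qC L (a, b)) by exact Ep.
assert (Eq' : qC J z = qC L (c, d)) by exact Eq.
rewrite Ep', Eq', <- qC_minus, qnorm_qC by assumption.
apply qC_eq in Ep'; trivial; apply qC_eq in Eq'; trivial.
assert (Hc : forall w, Cconj (Cconj w) = w).
{ intros [x y]; unfold Cconj; simpl; f_equal; ring. }
destruct Ep' as [-> | ->], Eq' as [-> | ->]; rewrite ?Hc, ?Cmod_conj_minus, ?Hc; auto.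
Qed.

(** The smaller distance is to whichever of p and its conjugate lies on the same side of the real
    axis as z. *)
Lemma off_line_dist (p z : C) : 0 <= Im p ->
  let s := sqrt ((Re z - Re p) ^ 2 + (Rabs (Im z) + Rabs (Im p)) ^ 2) in
  let t := sqrt ((Re z - Re p) ^ 2 + (Rabs (Im z) - Rabs (Im p)) ^ 2) in
  if Rle_dec 0 (Im z) then t = Cmod (z - p)%C /\ s = Cmod (z - Cconj p)%C
  else t = Cmod (z - Cconj p)%C /\ s = Cmod (z - p)%C.
Proof.
intros Hp; cbv zeta; rewrite (Rabs_pos_eq (Im p)) by exact Hp.
destruct (Rle_dec 0 (Im z)) as [H|H];
  [rewrite Rabs_pos_eq by exact H | rewrite Rabs_left by lra];
  unfold Cmod; split; f_equal; destruct z, p; unfold Re, Im; simpl; ring.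
Qed.

Lemma qtau_off_line (I J : quat) (p z : C) : imag_unit I -> imag_unit J ->
  ~ same_line (qC I p) (qC J z) ->
  qtau (qC J z) (qC I p) = sqrt ((Re z - Re p) ^ 2 + (Rabs (Im z) - Rabs (Im p)) ^ 2).
Proof.
intros HI HJ N; unfold qtau; destruct (excluded_middle_informative _); [contradiction|].
now rewrite !qre_qC, !qimnorm_qC.
Qed.

Lemma qsigma_off_line (I J : quat) (p z : C) : imag_unit I -> imag_unit J ->
  ~ same_line (qC I p) (qC J z) ->
  qsigma (qC J z) (qC I p) = sqrt ((Re z - Re p) ^ 2 + (Rabs (Im z) + Rabs (Im p)) ^ 2).
Proof.
intros HI HJ N; unfold qsigma; destruct (excluded_middle_informative _); [contradiction|].
now rewrite !qre_qC, !qimnorm_qC.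
Qed.

Lemma qtau_on_line (p q : quat) : same_line p q -> qtau q p = qnorm (q - p)%H.
Proof. intros H; unfold qtau; now destruct (excluded_middle_informative _). Qed.

Lemma qsigma_on_line (p q : quat) : same_line p q -> qsigma q p = qnorm (q - p)%H.
Proof. intros H; unfold qsigma; now destruct (excluded_middle_informative _). Qed.

Lemma qC_same_line (I : quat) (p z : C) : imag_unit I -> same_line (qC I p) (qC I z).
Proof.
intros HI; exists I; split; [exact HI|]; split; do 2 eexists; reflexivity.
Qed.

Lemma shell_slice (I : quat) (p z : C) (R1 R2 : R) : imag_unit I ->
  R1 < Cmod (z - p)%C < R2 -> shell (qC I p) R1 R2 (qC I z).
Proof.
intros HI H; assert (L := qC_same_line I p z HI).
unfold shell; rewrite qtau_on_line, qsigma_on_line by exact L.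
rewrite <- qC_minus, qnorm_qC by exact HI; exact H.
Qed.

(** Whichever clause defines them, tau and sigma are among the distances from z to p and to its
    conjugate, and the lens bounds both. *)
Lemma shell_lens (I K : quat) (p z : C) (R1 R2 : R) : imag_unit I -> imag_unit K ->
  0 <= Im p -> lens (Re p) (Im p) R1 R2 z -> shell (qC I p) R1 R2 (qC K z).
Proof.
intros HI HK Hp [H1 H2].
change (Re p, (- Im p)%R) with (Cconj p) in H2.
replace (Re p, Im p) with p in H1 by (destruct p; reflexivity).
unfold shell; simpl.
destruct (excluded_middle_informative (same_line (qC I p) (qC K z))) as [L|N].
- rewrite qtau_on_line, qsigma_on_line by exact L.
  destruct (same_line_qnorm I K p z HI HK L) as [-> | ->]; lra.
- rewrite (qtau_off_line I K), (qsigma_off_line I K) by assumption.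
  assert (D := off_line_dist p z Hp); cbv zeta in D.
  destruct (Rle_dec 0 (Im z)), D as [-> ->]; lra.
Qed.

Lemma qC_inj_l (I J : quat) (z : C) : Im z <> 0 -> qC I z = qC J z -> I = J.
Proof.
intros Hz H; rewrite !qC_split in H.
assert (E : forall K : quat, K = scal (/ Im z) ((quat_of_R (Re z) + scal (Im z) K) - quat_of_R (Re z))%H).
{ intros K; quat_destruct; quat_unfold; repeat apply (f_equal2 pair); field; exact Hz. }
rewrite (E I), (E J), H; reflexivity.
Qed.

Lemma shell_inv (I q : quat) (p : C) (R1 R2 : R) : imag_unit I -> 0 <= Im p ->
  shell (qC I p) R1 R2 q ->
  (exists z, q = qC I z /\ R1 < Cmod (z - p)%C < R2) \/
  (exists J z, imag_unit J /\ q = qC J z /\ 0 <= Im z /\ lens (Re p) (Im p) R1 R2 z).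
Proof.
intros HI Hp [H1 H2]; simpl in H2.
unfold lens; change (Re p, (- Im p)%R) with (Cconj p).
replace (Re p, Im p) with p by (destruct p; reflexivity).
destruct (quat_polar q) as (J & z & HJ & Hz & ->).
destruct (excluded_middle_informative (same_line (qC I p) (qC J z))) as [L|N].
- rewrite qtau_on_line in H1 by exact L; rewrite qsigma_on_line in H2 by exact L.
  (* A real p lies on every line, so the point need not be on that of [I]; but then p is its own
     conjugate and the lens is the annulus. *)
  destruct (Req_dec (Im p) 0) as [Hp0|Hp0].
  + right; exists J, z.
    assert (Ec : Cconj p = p) by (destruct p as [x y]; unfold Im in Hp0; simpl in Hp0; subst; unfold Cconj; simpl; f_equal; ring).
    rewrite Ec; destruct (same_line_qnorm I J p z HI HJ L) as [E|E]; rewrite ?Ec in E;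
      rewrite E in H1, H2; repeat split; trivial.
  + left; destruct L as (K & HK & (a & b & Ep) & (c & d & Eq)).
    assert (Ep' : qC I p = qC K (a, b)) by exact Ep.
    assert (Eq' : qC J z = qC K (c, d)) by exact Eq.
    rewrite Eq' in *; clear Eq Eq' Ep.
    (* A nonreal p determines its line, hence [K] is [I] or [- I]. *)
    assert (T : exists w, qC K (c, d) = qC I w).
    { destruct (qC_eq I K (a, b) p HI HK (eq_sym Ep')) as [E|E]; rewrite E in Ep'.
      - exists (c, d); now rewrite (qC_inj_l I K p Hp0 Ep').
      - exists (Cconj (c, d)); rewrite <- qC_opp in Ep'.
        assert (EK := qC_inj_l I (- K)%H p Hp0 Ep').
        rewrite EK, <- qC_opp; f_equal; clear; quat_auto. }
    destruct T as [w Ew]; exists w; split; [exact Ew|].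
    rewrite Ew, <- qC_minus, qnorm_qC in H1, H2 by exact HI; lra.
- right; exists J, z.
  rewrite (qtau_off_line I J) in H1 by assumption.
  rewrite (qsigma_off_line I J) in H2 by assumption.
  assert (D := off_line_dist p z Hp); cbv zeta in D.
  destruct (Rle_dec 0 (Im z)) as [_|]; [|contradiction].
  destruct D as [D1 D2].
  (* The shell bounds tau from below and sigma from above; tau <= sigma supplies the other two
     inequalities of the lens. *)
  assert (T : sqrt ((Re z - Re p) ^ 2 + (Rabs (Im z) - Rabs (Im p)) ^ 2)
            <= sqrt ((Re z - Re p) ^ 2 + (Rabs (Im z) + Rabs (Im p)) ^ 2)).
  { apply sqrt_le_1_alt; pose proof (Rabs_pos (Im z)); pose proof (Rabs_pos (Im p)); nra. }
  rewrite D1 in H1; rewrite D2 in H2.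
  rewrite D1, D2 in T.
  repeat split; trivial; lra.
Qed.

Lemma qmult_rep (A B x y a : quat) :
  ((A * x + B * y) * a)%H = (A * (x * a) + B * (y * a))%H.
Proof. quat_auto. Qed.

(* The coefficients depend on the shell: for p = 0, the function
   (q - 3/2)^{-1} on H \ {3/2} has different expansions for 0 < |q| < 1 and
   for |q| > 2.  One sequence serves all the shells around a given radius r. *)
Theorem theorem5p14 (f : quat -> quat) (Omega : quat -> Prop) (p : quat)
    (HOmega : is_domain Omega) (Hf : regular f Omega) (r : R) (Hr : 0 < r) :
  exists a : Z -> quat,
    forall (R1 : R) (R2 : Rbar),
      0 <= R1 -> R1 < r -> Rbar_lt r R2 ->
      (forall q : quat, shell p R1 R2 q -> Omega q) ->
      forall q : quat, shell p R1 R2 q ->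
        is_bilateral_series (fun n : Z => mult (reg_powZ p n q) (a n)) (f q).
Proof.
destruct HOmega as [HO _].
destruct (quat_polar p) as (I & z0 & HI & Hz0 & ->).
exists (laurent_coef f I z0 r).
intros R1 R2 HR1 Hr1 Hr2 HOm q Hq.
(* The planar results take a finite outer radius; any one beyond r and sigma(q, p) will do, since
   the coefficients depend on r alone. *)
assert (HR : exists R2' : R, r < R2' /\ Rbar_le R2' R2 /\ shell (qC I z0) R1 R2' q).
{ destruct Hq as [Hq1 Hq2]; destruct R2 as [R2| |]; [| |contradiction].
  - exists R2; repeat split; trivial; apply Rle_refl.
  - exists (Rmax r (qsigma q (qC I z0)) + 1).
    pose proof (Rmax_l r (qsigma q (qC I z0))); pose proof (Rmax_r r (qsigma q (qC I z0))).
    repeat split; trivial; simpl; lra. }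
clear Hq; destruct HR as (R2' & Hr2' & HR2 & Hq).
assert (HOm' : forall q, shell (qC I z0) R1 R2' q -> Omega q).
{ intros q' [S1 S2]; apply HOm; split; [exact S1|].
  exact (Rbar_lt_le_trans _ _ _ S2 HR2). }
assert (HL : forall z, R1 < Cmod (z - z0)%C < R2' ->
  is_bilateral_series (fun n => (reg_powZ (qC I z0) n (qC I z) * laurent_coef f I z0 r n)%H)
    (f (qC I z))).
{ intros z Hz; apply (laurent_qC f Omega I z0 z R1 R2' r); auto.
  intros w Hw; now apply HOm', shell_slice. }
destruct (shell_inv I q z0 R1 R2' HI Hz0 Hq) as [(z & -> & Hz) | (J & z & HJ & -> & Hz & Hl)].
- now apply HL.
- rewrite (representation f Omega I J (Re z0) (Im z0) R1 R2' z); trivial.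
  2: { intros K w HK Hw; now apply HOm', shell_lens. }
  destruct Hl as [Hl1 Hl2].
  change (Re z0, (- Im z0)%R) with (Cconj z0) in Hl2.
  replace (Re z0, Im z0) with z0 in Hl1 by (destruct z0; reflexivity).
  assert (N : forall w, R1 < Cmod (z - w)%C < R2' -> z <> w).
  { intros w Hw ->; replace (w - w)%C with (RtoC 0) in Hw by ring.
    rewrite Cmod_0 in Hw; lra. }
  (* The expansions at x + I y and x - I y share their coefficients, so their combination has as
     terms the representation formula of each power times its coefficient. The powers obey that
     formula because [N] keeps z off p and its conjugate. *)
  assert (B := bilateral_mult_plus (rep_l I J) (rep_r I J) _ _ _ _ (HL z Hl1)
    (HL (Cconj z) ltac:(rewrite Cmod_conj_minus; exact Hl2))).
  destruct B as (s1 & s2 & B1 & B2 & E); exists s1, s2; split; [|split; [|exact E]].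
  + revert B1; apply is_series_ext; intros k.
    rewrite (reg_powZ_rep I J z0 z) by auto; cbv beta.
    generalize (laurent_coef f I z0 r (Z.of_nat k)); intros a.
    symmetry; apply qmult_rep.
  + revert B2; apply is_series_ext; intros k.
    rewrite (reg_powZ_rep I J z0 z) by auto; cbv beta.
    generalize (laurent_coef f I z0 r (- Z.of_nat (S k))); intros a.
    symmetry; apply qmult_rep.
Qed.
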